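(* Let $p\ge1$. For all $\mathbf{x}=(x_1,\dots,x_p)\in\mathbb{C}^p$ and $\mathbf{s}=(s_1,\dots,s_p)\in\mathbb{C}^p$ with $\max_k|x_k|<1$, $$\mathbb{E}\left[Z_n^{\mathbf{s}}(\mathbf{x})\right]\longrightarrow\prod_{\mathbf{k}\in\mathbb{N}^p\setminus\{0\}}\left(1-\mathbf{x}^{\mathbf{k}}\right)^{-\binom{\mathbf{s}}{\mathbf{k}}(-1)^{\mathbf{k}}}\qquad(n\to\infty).$$
   Context: $\mathbb{N}=\{0,1,2,\dots\}$. For $\sigma$ in the symmetric group $S_n$, let $C_m^{(n)}=C_m^{(n)}(\sigma)$ be the number of cycles of length $m$ of $\sigma$. For $s\in\mathbb{C}$, $|x|<1$, set $Z_n^s(x):=\prod_{m=1}^n(1-x^m)^{sC_m^{(n)}}$, and $Z_n^{\mathbf{s}}(\mathbf{x}):=\prod_{k=1}^pZ_n^{s_k}(x_k)$. (For $s\in\mathbb{N}$ this is $\det(I-xg)^s$ with $g$ the permutation matrix of $\sigma$.) $\mathbb{E}$ is expectation with respect to the uniform measure on $S_n$. Powers $a^b$ with $a\in\mathbb{C}\setminus\mathbb{R}_{\le0}$, $b\in\mathbb{C}$ are defined by the principal branch of the logarithm. For $s\in\mathbb{C}$, $k\in\mathbb{N}$, $\binom{s}{k}:=\prod_{m=1}^k\frac{s-m+1}{m}$. Notation: $\mathbf{x}^{\mathbf{k}}:=\prod_{j=1}^p x_j^{k_j}$ and $\binom{\mathbf{s}}{\mathbf{k}}(-1)^{\mathbf{k}}:=\prod_{j=1}^p\binom{s_j}{k_j}(-1)^{k_j}$.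 *)

(* Defs.v *)
From mathcomp Require Import all_boot all_order all_fingroup all_algebra finmap.
From mathcomp.real_closed Require Import complex.
From mathcomp Require Import all_classical all_reals all_analysis.
From mathcomp.analysis.showcase Require summability.

Set Implicit Arguments.
Unset Strict Implicit.
Unset Printing Implicit Defensive.

Import Order.TTheory GRing.Theory Num.Theory.
Import numFieldNormedType.Exports.

Local Open Scope classical_set_scope.
Local Open Scope ring_scope.
Local Open Scope complex_scope.

Section Complex.
Variable R : realType.
Implicit Types z a b s : R[i].

Definition cmod z : R := complex.Re `|z|.

(* For z <> 0, the value of arg z in ]-pi, pi]. *)
Definition carg z : R :=
  let t := acos (complex.Re z / cmod z) in
  if 0 <= complex.Im z then t else - t.

Definition cln z : R[i] := ln (cmod z) +i* carg z.

Definition cexp z : R[i] :=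
  (expR (complex.Re z))%:C * (cos (complex.Im z) +i* sin (complex.Im z)).

(* Principal power; only meaningful for a outside the half-line of nonpositive
   reals, which contains no base of the form 1 - w with |w| < 1. *)
Definition cpow a b : R[i] := cexp (b * cln a).

Definition cbinom s (k : nat) : R[i] :=
  \prod_(1 <= m < k.+1) ((s - m%:R + 1) / m%:R).

(* The unordered product of F over D converges absolutely (\sum |F i - 1| is
   finite) and l is the limit of the products over the finite subsets of D,
   directed by inclusion. The regular module R[i]^o carries the usual
   topology of the complex plane. *)
Definition has_infprod (I : choiceType) (D : set I) (F : I -> R[i]) (l : R[i])
    : Prop :=
  summable D (fun i => (cmod (F i - 1))%:E) /\
  (fun A : {fset I} => (\prod_(i <- A | i \in D) F i : R[i]^o))
    @ summability.totally --> (l : R[i]^o).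

End Complex.

Definition ncycles (n m : nat) (g : 'S_n) : nat :=
  #|[set c in porbits g | #|c| == m]%SET|.

Section Z.
Variables (R : realType) (p n : nat).

Definition Z1 (s x : R[i]) (g : 'S_n) : R[i] :=
  \prod_(1 <= m < n.+1) cpow (1 - x ^+ m) (s * (ncycles m g)%:R).

Definition Z (s x : 'I_p -> R[i]) (g : 'S_n) : R[i] :=
  \prod_(k < p) Z1 (s k) (x k) g.

(* Expectation under the uniform probability on 'S_n. *)
Definition unifE (f : 'S_n -> R[i]) : R[i] :=
  (\sum_(g : 'S_n) f g) / #|{: 'S_n}|%:R.

End Z.

Section MultiIndex.
Variables (R : realType) (p : nat).

Definition mpower (x : 'I_p -> R[i]) (k : {ffun 'I_p -> nat}) : R[i] :=
  \prod_(j < p) x j ^+ k j.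

Definition sbinom (s : 'I_p -> R[i]) (k : {ffun 'I_p -> nat}) : R[i] :=
  \prod_(j < p) (cbinom (s j) (k j) * (-1) ^+ k j).

End MultiIndex.

(* Main.v *)
(* Put a_m = prod_j (1 - x_j^m)^(s_j) and b_m = a_m - 1, so that Z is the
   product of a_|c| over the cycles c of the permutation and b_m = O(r^m) with
   r = max_j |x_j|. Removing the cycle of a given point shows that e_n = E[Z]
   satisfies n e_n = sum_(1 <= m <= n) a_m e_(n-m), i.e. that the e_n are the
   partial sums of the coefficients of exp (sum_m b_m t^m / m). This series
   converges beyond t = 1, hence e_n -> exp (sum_m b_m / m). On the other side
   the binomial series gives b_m = sum_(k <> 0) binom(s, k) (-1)^k x^(m k), and
   log (1 - w) = - sum_m w^m / m turns sum_m b_m / m into the sum of the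
   logarithms of the factors of the infinite product.

   Both the logarithm series and the binomial series are instances of one fact
   (csum_expc): the coefficients defined by the recursion of exp (B(t)) sum to
   exp (B(1)). *)
Require Import Defs.
From mathcomp Require Import all_boot all_order all_fingroup all_algebra.
Set Implicit Arguments.
Unset Strict Implicit.
Unset Printing Implicit Defensive.
Import Order.TTheory GRing.Theory Num.Theory.
Local Open Scope ring_scope.

(** * Permutations weighted by their cycles *)

Section CycleWeights.
Variable T : finType.
Implicit Types (A B C D : {set T}) (g h k : {perm T}).

(** The recursions are formal identities between coefficients; the analysis rests on bounds
    [M * r ^+ n], weakened from [r] to a larger rate [q] wherever a convolution or a binomial
    coefficient costs more than a constant. Two obstacles shape the rest. The principal logarithm is
    built from [acos], so its agreement with the power series of log (1 - w) takes a connectedness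
    argument on top of an identity of exponentials. And the double sum over the multi-index k and
    the length m is never rearranged as an infinite one: the binomial series are cut at degree N,
    their product becomes a finite sum over the box of k with entries below N, and the error is
    geometric in N and in m at once. Boxes then control all large finite sets of multi-indices,
    since the logarithms of the factors are dominated by products of geometric weights. *)

Lemma porbit_eq_in C g h x :
    {in C, g =1 h} -> {in C, forall y, h y \in C} -> x \in C ->
  porbit g x = porbit h x.
Proof.
move=> gh hC Cx.
have step i : ((h ^+ i)%g x \in C) /\ (g ^+ i)%g x = (h ^+ i)%g x.
  elim: i => [|i [IC IE]]; first by rewrite !expg0 !perm1.
  by rewrite !expgSr !permM IE gh //; split=> //; apply: hC.
apply/setP=> y; apply/porbitP/porbitP => -[i ->]; exists i;
  by case: (step i).
Qed.

Lemma porbit_perm_on A g x : perm_on A g -> x \in A -> porbit g x \subset A.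
Proof.
move=> gA Ax; apply/subsetP=> _ /porbitP[i ->].
elim: i => [|i IH]; first by rewrite expg0 perm1.
by rewrite expgSr permM perm_closed.
Qed.

Lemma perm_onMl C B h k x : [disjoint C & B] -> perm_on C h -> perm_on B k ->
  x \in C -> (h * k)%g x = h x.
Proof.
move=> CB hC kB Cx; rewrite permM (out_perm kB) //.
by rewrite (disjointFr CB) // perm_closed.
Qed.

Lemma perm_onMr C B h k x : [disjoint C & B] -> perm_on C h ->
  x \in B -> (h * k)%g x = k x.
Proof.
by move=> CB hC Bx; rewrite permM (out_perm hC) // (disjointFl CB).
Qed.

Lemma porbit_perm_onMl C B h k x : [disjoint C & B] ->
  perm_on C h -> perm_on B k -> x \in C -> porbit (h * k) x = porbit h x.
Proof.
move=> CB hC kB; apply: porbit_eq_in => y Cy; last by rewrite perm_closed.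
exact: perm_onMl kB Cy.
Qed.

Lemma porbit_perm_onMr C B h k x : [disjoint C & B] ->
  perm_on C h -> perm_on B k -> x \in B -> porbit (h * k) x = porbit k x.
Proof.
move=> CB hC kB; apply: porbit_eq_in => y Cy; last by rewrite perm_closed.
exact: perm_onMr hC Cy.
Qed.

Definition cyclic_on C x := [pred h | perm_on C h & porbit h x == C].

Lemma mem_astabs_perm C g : {in C, forall y, g y \in C} -> g \in 'N(C | 'P)%g.
Proof.
move=> gC; rewrite !inE /=; apply/subsetP=> y Cy; rewrite inE /=.
exact: gC.
Qed.

(** [restr_perm] is trivial on a set that is not stabilised, so the content is that [g] maps both
    [C] and [A :\: C] into themselves. *)
Lemma perm_on_decomp A C x g : x \in C -> C \subset A ->
  perm_on A g -> porbit g x = C ->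
  (restr_perm C g * restr_perm (A :\: C) g)%g = g.
Proof.
move=> Cx CA gA gC.
have gCC y : y \in C -> g y \in C.
  rewrite -gC => /porbitP[i ->]; rewrite -permM -expgSr; exact: mem_porbit.
have gNC : g \in 'N(C | 'P)%g by exact: mem_astabs_perm.
have gNB : g \in 'N(A :\: C | 'P)%g.
  apply: mem_astabs_perm => y; rewrite !inE (perm_closed _ gA) => /andP[NCy ->].
  rewrite andbT; apply: contra NCy => gy.
  by move: gNC => /astabsP/(_ y) /= <-.
have CB : [disjoint C & A :\: C].
  by rewrite -setI_eq0 setIDA setIC -setIDA setDv setI0.
have rC := restr_perm_on C g; have rB := restr_perm_on (A :\: C) g.
apply/permP=> y; have [Cy|NCy] := boolP (y \in C).
  by rewrite (perm_onMl CB rC rB) // restr_permE.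
have [Ay|NAy] := boolP (y \in A).
  by rewrite (perm_onMr _ CB rC) ?restr_permE // !inE NCy.
rewrite permM (out_perm rC) // (out_perm rB) ?(out_perm gA) //.
by rewrite !inE negb_and NAy orbT.
Qed.

Variable F : comNzRingType.
Variable a : nat -> F.

(** Only orbits of points of [A] count: a fixed point in [A] contributes [a 1], one outside nothing.
    Working with supports inside a fixed type, the removal of a cycle needs no relabelling. *)
Definition cweight A g : F := \prod_(c in porbit g @: A) a #|c|.
Definition wsum A : F := \sum_(g | perm_on A g) cweight A g.

Lemma cweightM A C x h k : x \in C -> C \subset A -> cyclic_on C x h ->
  perm_on (A :\: C) k -> cweight A (h * k)%g = a #|C| * cweight (A :\: C) k.
Proof.
move=> Cx CA /andP[hC /eqP hx] kB.
have CB : [disjoint C & A :\: C].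
  by rewrite -setI_eq0 setIDA setIC -setIDA setDv setI0.
have -> : cweight A (h * k)%g =
    \prod_(c in [set C] :|: (porbit k @: (A :\: C))) a #|c|.
  apply: eq_bigl => c; congr (c \in pred_of_set _).
  have AE : A = C :|: (A :\: C).
    by rewrite setDE setUIr setUCr setIT; apply/esym/setUidPr.
  rewrite {1}AE imsetU.
  have -> : porbit (h * k) @: (A :\: C) = porbit k @: (A :\: C).
    by apply: eq_in_imset => y By; exact: (porbit_perm_onMr CB hC kB By).
  have Cconst : {in C, porbit (h * k) =1 (fun=> C)}.
    move=> y Cy; rewrite (porbit_perm_onMl CB hC kB Cy).
    by rewrite -[RHS]hx; apply/eqP; rewrite eq_porbit_mem hx.
  rewrite (eq_in_imset Cconst); congr (_ :|: _).
  apply/setP=> D; rewrite inE; apply/imsetP/eqP => [[y _ ->]//|->].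
  by exists x.
rewrite (@big_setU1 _ _ _ _ C) ?(negPf _) //=.
apply/imsetP=> -[y By Cy]; move: (porbit_id k y); rewrite -Cy => yC.
by move: By; rewrite inE yC.
Qed.

(** Sort by the cycle [C] of [x] and split it off. The weight does not depend on which cyclic
    permutation of [C] occurs, so these enter only through their number. *)
Lemma wsum_rec A x : x \in A ->
  wsum A = \sum_(C : {set T} | (x \in C) && (C \subset A))
             (#|cyclic_on C x|%:R * a #|C| * wsum (A :\: C)).
Proof.
move=> Ax; rewrite /wsum.
rewrite (partition_big (fun g => porbit g x)
          (fun C => (x \in C) && (C \subset A))) /=; last first.
  by move=> g gA; rewrite porbit_id porbit_perm_on.
apply: eq_bigr => C /andP[Cx CA].
have CB : [disjoint C & A :\: C].
  by rewrite -setI_eq0 setIDA setIC -setIDA setDv setI0.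
rewrite (reindex_onto (fun hk : {perm T} * {perm T} => (hk.1 * hk.2)%g)
  (fun g => (restr_perm C g, restr_perm (A :\: C) g))) /=; last first.
  by move=> g /andP[gA /eqP gC]; apply: perm_on_decomp Cx CA gA gC.
transitivity (\sum_(hk | cyclic_on C x hk.1 && perm_on (A :\: C) hk.2)
   (a #|C| * cweight (A :\: C) hk.2)).
  apply: eq_big => [[h k] | [h k]] /=; last first.
    move=> /andP[/andP[hkA /eqP hkC] /eqP[hE kE]].
    have hC : perm_on C h by rewrite -hE restr_perm_on.
    have kB : perm_on (A :\: C) k by rewrite -kE restr_perm_on.
    apply: (@cweightM _ _ x) => //=; rewrite hC /=.
    by rewrite -(porbit_perm_onMl CB hC kB Cx) hkC.
  apply/idP/idP => [/andP[/andP[hkA /eqP hkC] /eqP[hE kE]]|].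
    have hC : perm_on C h by rewrite -hE restr_perm_on.
    have kB : perm_on (A :\: C) k by rewrite -kE restr_perm_on.
    by rewrite hC -(porbit_perm_onMl CB hC kB Cx) hkC eqxx kB.
  move=> /andP[/andP[hC /eqP hx] kB].
  have hkC y : y \in C -> (h * k)%g y \in C.
    by move=> Cy; rewrite (perm_onMl CB hC kB Cy) perm_closed.
  have hkB y : y \in A :\: C -> (h * k)%g y \in A :\: C.
    by move=> By; rewrite (perm_onMr _ CB hC By) perm_closed.
  rewrite (porbit_perm_onMl CB hC kB Cx) hx eqxx andbT.
  apply/andP; split.
    apply: perm_onM; [exact: subset_trans hC CA | apply: subset_trans kB _].
    exact: subsetDl.
  have rC := restr_perm_on C (h * k)%g.
  have rB := restr_perm_on (A :\: C) (h * k)%g.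
  apply/eqP; congr (_, _); apply/permP => y.
    have [Cy|NCy] := boolP (y \in C).
      by rewrite restr_permE ?(perm_onMl CB hC kB) // mem_astabs_perm.
    by rewrite (out_perm rC) // (out_perm hC).
  have [By|NBy] := boolP (y \in A :\: C).
    by rewrite restr_permE ?(perm_onMr _ CB hC) // mem_astabs_perm.
  by rewrite (out_perm rB) // (out_perm kB).
rewrite -(pair_big (cyclic_on C x) (perm_on (A :\: C))
  (fun _ k => a #|C| * cweight (A :\: C) k)) /=.
by rewrite sumr_const -mulr_sumr -[LHS]mulr_natl mulrA.
Qed.

Lemma sum_subsets_with A x (f : {set T} -> F) : x \in A ->
  \sum_(C : {set T} | (x \in C) && (C \subset A)) f C =
  \sum_(D : {set T} | D \subset A :\ x) f (x |: D).
Proof.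
move=> Ax; rewrite (reindex_onto (fun D => x |: D) (fun C => C :\ x)) /=.
  apply: eq_bigl => D; rewrite setU11 /= subUset sub1set Ax /=.
  rewrite subsetD1; congr (_ && _).
  by apply/eqP/idP => [<-|]; [rewrite !inE eqxx | exact: setU1K].
by move=> C /andP[xC _]; rewrite setD1K.
Qed.

Lemma sum_subsets_card A (f : nat -> F) :
  \sum_(D : {set T} | D \subset A) f #|D| =
  \sum_(k < #|A|.+1) 'C(#|A|, k)%:R * f k.
Proof.
rewrite (partition_big (fun D : {set T} => inord #|D| : 'I_#|A|.+1) xpredT) //=.
apply: eq_bigr => k _; rewrite -cards_draws mulr_natl -sumr_const.
apply: eq_big => [D|D /andP[DA /eqP<-]]; last by rewrite inordK // ltnS subset_leq_card.
rewrite inE; case DA: (D \subset A) => //=.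
by rewrite -val_eqE /= inordK // ltnS subset_leq_card.
Qed.

End CycleWeights.

Lemma card_setD_setU1 (T : finType) (A D : {set T}) x :
  x \in A -> D \subset A :\ x ->
  #|x |: D| = #|D|.+1 /\ #|A :\: (x |: D)| = (#|A :\ x| - #|D|)%N.
Proof.
move=> Ax DA; have xD : x \notin D by move: DA; rewrite subsetD1 => /andP[].
split; first by rewrite cardsU1 xD.
by rewrite -setDDl cardsD (setIidPr DA).
Qed.

Lemma wsum1 (T : finType) (F : comNzRingType) (A : {set T}) :
  wsum (fun=> 1 : F) A = (#|A|`!)%:R.
Proof.
rewrite /wsum -card_perm -sumr_const; apply: eq_bigr => g _.
by rewrite /cweight big1.
Qed.

(* Counting all permutations of C by the cycle of x, everything cancels by
   induction except the count of cyclic permutations of C itself. *)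
Lemma card_cyclic_on (T : finType) (C : {set T}) x : x \in C ->
  #|cyclic_on C x| = (#|C|.-1)`!.
Proof.
have [n] := ubnP #|C|; elim: n C => // n IH C; rewrite ltnS => Cn Cx.
apply/eqP; rewrite -(eqr_nat rat).
pose c1 : nat -> rat := fun=> 1.
have := wsum_rec c1 Cx; rewrite sum_subsets_with // wsum1.
set N := #|C :\ x|.
have CN : #|C| = N.+1 by rewrite (cardsD1 x) Cx.
(* There are 'C(N, k) subsets of size k, each contributing k! (N - k)!, so each of the N + 1 sizes
   contributes N!. *)
have facts : (#|C|`!)%:R =
    \sum_(D : {set T} | D \subset C :\ x) ((#|D|)`! * (N - #|D|)`!)%:R :> rat.
  rewrite (sum_subsets_card (C :\ x) (fun k => (k`! * (N - k)`!)%:R)) -/N.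
  rewrite (eq_bigr (fun=> (N`!)%:R)) => [|k _].
    by rewrite sumr_const card_ord CN factS natrM mulr_natl.
  by rewrite -natrM bin_fact // -ltnS.
rewrite {1}facts (bigD1 (C :\ x)) //= [in RHS](bigD1 (C :\ x)) //=.
rewrite setD1K // setDv wsum1 cards0 -/N subnn mulr1 fact0 !muln1 mulr1.
rewrite [X in _ + X = _](_ : _ = \sum_(D : {set T} | (D \subset C :\ x) && (D != C :\ x))
  #|cyclic_on (x |: D) x|%:R * c1 #|x |: D| * wsum c1 (C :\: (x |: D))).
  by move/addIr => <-; rewrite CN.
apply: eq_bigr => D /andP[DC DNC].
have [cD cCD] := card_setD_setU1 Cx DC.
rewrite IH ?setU11 //; first by rewrite wsum1 cD cCD mulr1 natrM.
apply: leq_trans Cn; rewrite cD CN ltnS; apply: proper_card.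
by rewrite properEneq DNC.
Qed.

(** The hypotheses say that [e] lists the coefficients of exp (sum_m a_m t^m / m). A cycle of length
    k + 1 through [x] has 'C(N, k) possible supports and k! arrangements, the rest has total weight
    (N - k)! e_(N-k), and the factorials collapse to N!. *)
Lemma wsum_cycle_index (T : finType) (F : comNzRingType) (a e : nat -> F) :
    e 0 = 1 ->
    (forall n, n.+1%:R * e n.+1 = \sum_(k < n.+1) a k.+1 * e (n - k)%N) ->
  forall A : {set T}, wsum a A = (#|A|`!)%:R * e #|A|.
Proof.
move=> e0 eS A; have [n] := ubnP #|A|; elim: n A => // n IH A; rewrite ltnS.
have [->|[x Ax]] := set_0Vmem A => An.
  rewrite cards0 e0 mulr1 /wsum (eq_bigl (pred1 1%g)).
    by rewrite big_pred1_eq /cweight imset0 big_set0.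
  move=> g /=; apply/idP/eqP => [|->]; last exact: perm_on1.
  by move/perm_on_id; apply; rewrite cards0.
rewrite (wsum_rec a Ax) sum_subsets_with //; set N := #|A :\ x|.
have AN : #|A| = N.+1 by rewrite (cardsD1 x) Ax.
transitivity (\sum_(D : {set T} | D \subset A :\ x)
   ((#|D|)`! * (N - #|D|)`!)%:R * (a #|D|.+1 * e (N - #|D|)%N)).
  apply: eq_bigr => D DA; have [cD cAD] := card_setD_setU1 Ax DA.
  rewrite card_cyclic_on ?setU11 // cD IH cAD; last first.
    by apply: leq_trans An; rewrite AN ltnS leq_subr.
  by rewrite natrM -/N -!mulrA; congr (_ * _); rewrite mulrCA.
rewrite (sum_subsets_card (A :\ x)
  (fun k => (k`! * (N - k)`!)%:R * (a k.+1 * e (N - k)%N))) -/N AN.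
rewrite factS mulnC natrM -mulrA eS mulr_sumr.
by apply: eq_bigr => k _; rewrite mulrA -natrM bin_fact // -ltnS.
Qed.

From mathcomp Require Import finmap.
From mathcomp.real_closed Require Import complex.
From mathcomp Require Import all_classical all_reals all_analysis.
From mathcomp.analysis.showcase Require summability.
From mathcomp Require Import ring lra.
Import numFieldNormedType.Exports.
Local Open Scope classical_set_scope.
Local Open Scope ring_scope.
Local Open Scope complex_scope.

(** * Complex modulus and convergence *)

Section Modulus.
Variable R : realType.
Implicit Types (z w : R[i]) (x y : R).

Lemma cmodE z : `|z| = (cmod z)%:C.
Proof. by rewrite /cmod normc_def. Qed.

Lemma cmodEsqrt z : cmod z = Num.sqrt (complex.Re z ^+ 2 + complex.Im z ^+ 2).
Proof. by rewrite /cmod normc_def. Qed.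

Lemma cmod_ge0 z : 0 <= cmod z.
Proof. by rewrite cmodEsqrt sqrtr_ge0. Qed.

Lemma cmod0 : cmod (0 : R[i]) = 0.
Proof. by rewrite /cmod normr0. Qed.

Lemma cmod1 : cmod (1 : R[i]) = 1.
Proof. by rewrite /cmod normr1. Qed.

Lemma cmodN z : cmod (- z) = cmod z.
Proof. by rewrite /cmod normrN. Qed.

Lemma cmodB z w : cmod (z - w) = cmod (w - z).
Proof. by rewrite /cmod distrC. Qed.

Lemma cmodM z w : cmod (z * w) = cmod z * cmod w.
Proof. by apply/complexI; rewrite rmorphM /= -!cmodE normrM. Qed.

Lemma cmodX z n : cmod (z ^+ n) = cmod z ^+ n.
Proof. by apply/complexI; rewrite rmorphXn /= -!cmodE normrX. Qed.

Lemma cmod_eq0 z : (cmod z == 0) = (z == 0).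
Proof. by rewrite -(inj_eq (@complexI R)) -cmodE normr_eq0. Qed.

Lemma cmodV z : cmod z^-1 = (cmod z)^-1.
Proof. by apply/complexI; rewrite fmorphV /= -!cmodE normfV. Qed.

Lemma cmodD z w : cmod (z + w) <= cmod z + cmod w.
Proof. by rewrite -lecR rmorphD /= -!cmodE ler_normD. Qed.

Lemma cmodBD z w : cmod (z - w) <= cmod z + cmod w.
Proof. by rewrite (le_trans (cmodD _ _)) // cmodN. Qed.

Lemma cmod_triangle u z w : cmod (z - w) <= cmod (z - u) + cmod (u - w).
Proof. by rewrite (le_trans _ (cmodD _ _)) // addrA subrK. Qed.

Lemma cmod_sum (I : Type) (r : seq I) (P : pred I) (F : I -> R[i]) :
  cmod (\sum_(i <- r | P i) F i) <= \sum_(i <- r | P i) cmod (F i).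
Proof.
elim/big_ind2 : _ => [|z x w y zx wy|//]; first by rewrite cmod0.
by rewrite (le_trans (cmodD _ _)) // lerD.
Qed.

Lemma cmod_prod (I : Type) (r : seq I) (P : pred I) (F : I -> R[i]) :
  cmod (\prod_(i <- r | P i) F i) = \prod_(i <- r | P i) cmod (F i).
Proof. exact: (big_morph _ cmodM cmod1). Qed.

Lemma cmod_real x : cmod x%:C = `|x|.
Proof. by rewrite cmodEsqrt /= expr0n addr0 sqrtr_sqr. Qed.

Lemma cmod_nat n : cmod (n%:R : R[i]) = n%:R.
Proof. by rewrite -(rmorph_nat (real_complex R)) cmod_real ger0_norm. Qed.

Lemma Re_le_cmod z : `|complex.Re z| <= cmod z.
Proof. by rewrite cmodEsqrt -sqrtr_sqr ler_wsqrtr // lerDl sqr_ge0. Qed.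

Lemma Im_le_cmod z : `|complex.Im z| <= cmod z.
Proof. by rewrite cmodEsqrt -sqrtr_sqr ler_wsqrtr // lerDr sqr_ge0. Qed.

Lemma cmod_le_ReIm z : cmod z <= `|complex.Re z| + `|complex.Im z|.
Proof.
rewrite cmodEsqrt -[leRHS]ger0_norm ?addr_ge0 // -sqrtr_sqr ler_wsqrtr //.
by rewrite sqrrD !real_normK ?num_real // lerD2r lerDl mulrn_wge0 // mulr_ge0.
Qed.

Lemma ltc1_cmod z : (`|z| < 1) = (cmod z < 1).
Proof. by rewrite cmodE -[1 in LHS](rmorph1 (real_complex R)) ltcR. Qed.

Lemma ReD z w : complex.Re (z + w) = complex.Re z + complex.Re w.
Proof. by case: z w => [? ?] [? ?]. Qed.
Lemma ImD z w : complex.Im (z + w) = complex.Im z + complex.Im w.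
Proof. by case: z w => [? ?] [? ?]. Qed.
Lemma ReB z w : complex.Re (z - w) = complex.Re z - complex.Re w.
Proof. by case: z w => [? ?] [? ?]. Qed.
Lemma ImB z w : complex.Im (z - w) = complex.Im z - complex.Im w.
Proof. by case: z w => [? ?] [? ?]. Qed.

Lemma Re_sum (I : Type) (r : seq I) (P : pred I) (F : I -> R[i]) :
  complex.Re (\sum_(i <- r | P i) F i) = \sum_(i <- r | P i) complex.Re (F i).
Proof. exact: (big_morph _ ReD). Qed.
Lemma Im_sum (I : Type) (r : seq I) (P : pred I) (F : I -> R[i]) :
  complex.Im (\sum_(i <- r | P i) F i) = \sum_(i <- r | P i) complex.Im (F i).
Proof. exact: (big_morph _ ImD). Qed.

(** Reduces complex limits to real ones. The filter is arbitrary because both n -> oo and the filter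
    of finite sets of multi-indices occur. *)
Lemma cvg_cmodP (T : Type) (F : set_system T) (FF : Filter F)
    (f : T -> R[i]) (l : R[i]) :
  ((f : T -> R[i]^o) @ F --> (l : R[i]^o)) <->
  ((fun t => cmod (f t - l)) @ F --> (0 : R)).
Proof.
split=> H.
  apply/cvgr0Pnorm_lt => e e0.
  have : \forall t \near F, `|(l : R[i]^o) - f t| < e%:C.
    by apply: cvgr_dist_lt => //; rewrite ltcE /= eqxx e0.
  apply: filterS => t; rewrite distrC (cmodE (f t - l)) ltcR.
  by rewrite (ger0_norm (cmod_ge0 _)).
apply/cvgrPdist_lt => e e0.
(* Positivity in the order of [R[i]] forces [e] to be real. *)
have eE : e = (complex.Re e)%:C by rewrite RRe_real // gtr0_real.
have e0' : 0 < complex.Re e by move: e0; rewrite ltcE => /andP[].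
move/cvgr0Pnorm_lt: H => /(_ _ e0'); apply: filterS => t.
by rewrite distrC (cmodE (f t - l)) {2}eE ltcR ger0_norm // cmod_ge0.
Qed.

End Modulus.

(** * Geometrically bounded series *)

Section Series.
Variable R : realType.
Implicit Types (u v : nat -> R[i]) (r M : R).

Lemma sum_geo_le r n : 0 <= r < 1 -> \sum_(k < n) r ^+ k <= (1 - r)^-1.
Proof.
move=> /andP[r0 r1]; have r1' : 0 < 1 - r by rewrite subr_gt0.
rewrite -(ler_pM2l r1') mulfV ?gt_eqF // -opprB mulNr -subrX1 opprB.
by rewrite gerBl exprn_ge0.
Qed.

Lemma cvg_geo0 M r : 0 <= r < 1 -> (fun n => M * r ^+ n) @ \oo --> 0.
Proof. by move=> /andP[r0 r1]; apply: cvg_geometric; rewrite ger0_norm. Qed.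

(** [lim] is a default value on divergent series; the algebraic laws below therefore carry a
    geometric bound, which supplies convergence. *)
Definition csum u : R[i] := lim (series (u : nat -> R[i]^o) @ \oo).

Lemma csum_def u (l : R[i]) :
  series (u : nat -> R[i]^o) @ \oo --> (l : R[i]^o) -> csum u = l.
Proof. by move=> ul; apply: cvg_lim ul => //; apply: norm_hausdorff. Qed.

Lemma cvg_norm_sub (f : nat -> R) (a : R) :
  f @ \oo --> a -> (fun n => `|f n - a|) @ \oo --> 0.
Proof.
move=> fa; rewrite -(normr0 R) -(subrr a); apply: cvg_norm.
by apply: cvgB => //; exact: cvg_cst.
Qed.

Lemma cvg_geo_bounded (f : nat -> R) M r : 0 <= r < 1 ->
  (forall n, `|f n| <= M * r ^+ n) -> cvgn (series f).
Proof.
move=> /andP[r0 r1] fM; apply: normed_cvg.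
apply: series_le_cvg (@is_cvg_geometric_series _ M r _) => //=.
- by move=> n; apply: le_trans (fM n).
- by rewrite ger0_norm.
Qed.

Lemma csum_cvg u M r : 0 <= r < 1 -> (forall n, cmod (u n) <= M * r ^+ n) ->
  series (u : nat -> R[i]^o) @ \oo --> (csum u : R[i]^o).
Proof.
move=> r01 uM.
have /cvg_ex[/= a ca] : cvgn (series (fun n => complex.Re (u n))).
  by apply: cvg_geo_bounded r01 _ => n; apply: le_trans (uM n); exact: Re_le_cmod.
have /cvg_ex[/= b cb] : cvgn (series (fun n => complex.Im (u n))).
  by apply: cvg_geo_bounded r01 _ => n; apply: le_trans (uM n); exact: Im_le_cmod.
suff H : series (u : nat -> R[i]^o) @ \oo --> ((a +i* b : R[i]) : R[i]^o).
  by rewrite (csum_def H).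
apply/cvg_cmodP.
apply: (@squeeze_cvgr _ _ _ _ (fun=> 0) (fun n =>
  `|series (fun n => complex.Re (u n)) n - a| +
  `|series (fun n => complex.Im (u n)) n - b|)).
- near=> n; rewrite cmod_ge0 /=; apply: le_trans (cmod_le_ReIm _) _.
  by rewrite ReB ImB /series /= Re_sum Im_sum.
- exact: cvg_cst.
- rewrite -[0 in X in _ --> X]addr0; apply: cvgD.
    exact: cvg_norm_sub.
  exact: cvg_norm_sub.
Unshelve. all: by end_near. Qed.

Lemma cvg_squeeze0 (f g : nat -> R) :
  (forall n, 0 <= f n <= g n) -> g @ \oo --> 0 -> f @ \oo --> 0.
Proof.
move=> fg g0; apply: (@squeeze_cvgr _ _ _ _ (fun=> 0) g) => //.
  by near=> n; exact: fg.
exact: cvg_cst.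
Unshelve. all: by end_near. Qed.

Lemma cmod_lim_le (f : nat -> R[i]) (l : R[i]) M :
  (f : nat -> R[i]^o) @ \oo --> (l : R[i]^o) ->
  (\forall n \near \oo, cmod (f n) <= M) -> cmod l <= M.
Proof.
move=> /cvg_cmodP fl fM; rewrite -subr_le0; apply: cvgr_to_ge fl _.
near=> n; have fn : cmod (f n) <= M by near: n.
rewrite lerBlDr -[l in leLHS](subrK (f n)) (le_trans (cmodD _ _)) //.
by rewrite lerD // cmodB.
Unshelve. all: by end_near. Qed.

Lemma csum_tail u M r N : 0 <= r < 1 -> (forall n, cmod (u n) <= M * r ^+ n) ->
  cmod (csum u - \sum_(k < N) u k) <= M * r ^+ N / (1 - r).
Proof.
move=> r01 uM; have [r0 r1] := andP r01.
have M0 : 0 <= M by have := uM 0%N; rewrite expr0 mulr1; apply: le_trans; exact: cmod_ge0.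
have H : (fun n => series (u : nat -> R[i]^o) n - \sum_(k < N) u k : R[i]^o) @ \oo
    --> (csum u - \sum_(k < N) u k : R[i]^o).
  by apply: cvgB; [exact: csum_cvg r01 uM | exact: cvg_cst].
apply: cmod_lim_le H _; near=> n.
have Nn : (N <= n)%N by near: n; exists N.
rewrite /series /= -(big_mkord xpredT u) (big_cat_nat (n := N)) //= addrAC subrr add0r.
rewrite (le_trans (cmod_sum _ _ _)) // -mulrA.
rewrite -{1}(add0n N) big_addn big_mkord.
apply: (@le_trans _ _ (\sum_(k < n - N) M * (r ^+ N * r ^+ k))).
  by apply: ler_sum => k _; rewrite -exprD addnC.
rewrite -!mulr_sumr ler_wpM2l // ler_wpM2l ?exprn_ge0 //.
exact: sum_geo_le.
Unshelve. all: by end_near. Qed.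

Lemma csum_le u M r : 0 <= r < 1 -> (forall n, cmod (u n) <= M * r ^+ n) ->
  cmod (csum u) <= M / (1 - r).
Proof.
by move=> r01 uM; have := csum_tail 0 r01 uM; rewrite big_ord0 subr0 expr0 mulr1.
Qed.

Lemma csumZ u (a : R[i]) M r : 0 <= r < 1 ->
  (forall n, cmod (u n) <= M * r ^+ n) ->
  csum (fun n => a * u n) = a * csum u.
Proof.
move=> r01 uM; apply/csum_def/cvg_cmodP.
have /cvg_cmodP := csum_cvg r01 uM => H.
rewrite -(mulr0 (cmod a)).
have -> : (fun n => cmod (series ((fun n => a * u n) : nat -> R[i]^o) n - a * csum u)) =
    (fun n => cmod a * cmod (series (u : nat -> R[i]^o) n - csum u)).
  by apply/funext => n; rewrite -cmodM mulrBr /series /= mulr_sumr.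
by apply: cvgM => //; exact: cvg_cst.
Qed.

Lemma csumD u v M r : 0 <= r < 1 ->
  (forall n, cmod (u n) <= M * r ^+ n) -> (forall n, cmod (v n) <= M * r ^+ n) ->
  csum (fun n => u n + v n) = csum u + csum v.
Proof.
move=> r01 uM vM; apply/csum_def.
have -> : series ((fun n => u n + v n) : nat -> R[i]^o) =
    (fun n => series (u : nat -> R[i]^o) n + series (v : nat -> R[i]^o) n).
  by apply/funext => n; rewrite /series /= big_split.
by apply: cvgD; [exact: csum_cvg r01 uM | exact: csum_cvg r01 vM].
Qed.

Lemma csumS u M r : 0 <= r < 1 -> (forall n, cmod (u n) <= M * r ^+ n) ->
  csum u = u 0%N + csum (fun n => u n.+1).
Proof.
move=> r01 uM; have [r0 r1] := andP r01.
have uM' n : cmod (u n.+1) <= M * r * r ^+ n by rewrite -mulrA -exprS.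
apply/csum_def; rewrite -cvg_shiftS.
have -> : [sequence series (u : nat -> R[i]^o) n.+1]_n =
    (fun n => u 0%N + series ((fun n => u n.+1) : nat -> R[i]^o) n).
  by apply/funext => n; rewrite /series /= big_nat_recl.
by apply: cvgD; [exact: cvg_cst | exact: csum_cvg r01 uM'].
Qed.

End Series.

(** * Cauchy products and coefficients of exponentials *)

Section CauchyProduct.
Variable R : realType.
Implicit Types (u v w : nat -> R[i]) (r M : R).

Definition cauchyp u v (n : nat) : R[i] := \sum_(i < n.+1) u i * v (n - i)%N.

Lemma sum_cauchyp u v N :
  \sum_(n < N) cauchyp u v n = \sum_(i < N) u i * \sum_(j < N - i) v j.
Proof.
elim: N => [|N IH]; first by rewrite !big_ord0.
rewrite big_ord_recr IH /= [RHS]big_ord_recr /= subSnn big_ord1.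
rewrite /cauchyp big_ord_recr /= subnn addrA; congr (_ + _).
rewrite -big_split /=; apply: eq_bigr => i _.
by rewrite -mulrDr subSn 1?ltnW // big_ord_recr.
Qed.

(** The midpoint stays positive even for [r = 0], so it can be divided by; [r / q < 1] turns a sum
    of [r ^+ i * q ^+ (N - i)] into [q ^+ N] times a bounded one. *)
Lemma half_rate r : 0 <= r < 1 -> [/\ 0 < (1 + r) / 2, (1 + r) / 2 < 1,
  r < (1 + r) / 2 & 0 <= r / ((1 + r) / 2) < 1].
Proof.
move=> /andP[r0 r1]; have h : 0 < (1 + r) / 2 by lra.
split=> //; [lra|lra|].
by rewrite divr_ge0 //=; [rewrite ltr_pdivrMr //; lra|lra].
Qed.

(** In the triangular partial sum, [u i] meets the sum of [v] cut at N - i. The missing tails form a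
    convolution of two geometric sequences, which at a common rate would carry a factor N; weakening
    the bound on [v] to rate [q] avoids it. *)
Lemma csum_cauchyp u v M r : 0 <= r < 1 ->
    (forall n, cmod (u n) <= M * r ^+ n) ->
    (forall n, cmod (v n) <= M * r ^+ n) ->
  csum (cauchyp u v) = csum u * csum v.
Proof.
move=> r01 uM vM; have [r0 r1] := andP r01.
have M0 : 0 <= M by have := uM 0%N; rewrite expr0 mulr1; apply: le_trans; exact: cmod_ge0.
have [q0 q1 rq rq1] := half_rate r01; move: ((1 + r) / 2) q0 q1 rq rq1 => q q0 q1 rq rq1.
have q01 : 0 <= q < 1 by rewrite ltW.
have vM' n : cmod (v n) <= M * q ^+ n.
  by rewrite (le_trans (vM n)) // ler_wpM2l // lerXn2r // ?nnegrE ltW.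
apply/csum_def/cvg_cmodP.
pose K := M * (M / (1 - q)) * (1 - r / q)^-1.
apply: (@cvg_squeeze0 _ _ (fun N =>
    K * q ^+ N + (M / (1 - r) * cmod (csum v)) * r ^+ N)); last first.
  by rewrite -[0 in X in _ --> X]addr0; apply: cvgD; exact: cvg_geo0.
move=> N; rewrite cmod_ge0 /=.
rewrite /series /= big_mkord sum_cauchyp.
apply: le_trans (cmod_triangle ((\sum_(i < N) u i) * csum v) _ _) _.
apply: lerD; last first.
  rewrite -mulrBl cmodM mulrAC ler_wpM2r ?cmod_ge0 // cmodB mulrAC.
  exact: csum_tail.
rewrite mulr_suml -sumrB (le_trans (cmod_sum _ _ _)) //.
apply: (@le_trans _ _ (\sum_(i < N) M * (M / (1 - q)) * q ^+ N * (r / q) ^+ i)).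
  apply: ler_sum => i _; rewrite -mulrBr cmodM cmodB.
  have qN : q ^+ N = q ^+ i * q ^+ (N - i) by rewrite -exprD subnKC // ltnW.
  have -> : M * (M / (1 - q)) * q ^+ N * (r / q) ^+ i =
     (M * r ^+ i) * (M * q ^+ (N - i) / (1 - q)).
    rewrite qN expr_div_n; field.
    by rewrite expf_neq0 ?gt_eqF ?subr_gt0.
  by apply: ler_pM; rewrite ?cmod_ge0 //; exact: csum_tail.
rewrite -mulr_sumr /K [leRHS]mulrAC; apply: ler_wpM2l; last exact: sum_geo_le.
have q1' : 0 <= 1 - q by rewrite subr_ge0 ltW.
by rewrite !mulr_ge0 ?invr_ge0 ?exprn_ge0 // ltW.
Qed.

(** Lets truncated polynomials stand for power series, which gives access to the product rule and to
    [ring]. *)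
Lemma cauchyp_poly u v N n : (n < N)%N ->
  cauchyp u v n = ((\poly_(i < N) u i) * (\poly_(i < N) v i))`_n.
Proof.
move=> nN; rewrite coefM; apply: eq_bigr => i _.
have iN : (i <= n)%N by rewrite -ltnS.
by rewrite !coef_poly (leq_ltn_trans iN nN) (leq_ltn_trans (leq_subr _ _) nN).
Qed.

(* [expc b] lists the coefficients of the power series E with E(0) = 1 and
   E' = b E, that is, of exp (\sum_n b_n t^(n+1) / (n+1)). *)
Fixpoint expc_upto (b : nat -> R[i]) (N : nat) : nat -> R[i] :=
  if N is N'.+1 then fun n => if (n <= N')%N then expc_upto b N' n
    else (N'.+1%:R)^-1 * cauchyp b (expc_upto b N') N'
  else fun=> 1.

Definition expc b n := expc_upto b n n.

Lemma expc_uptoE b N n : (n <= N)%N -> expc_upto b N n = expc b n.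
Proof.
elim: N => [|N IH]; first by rewrite leqn0 => /eqP->.
rewrite leq_eqVlt => /predU1P[->//|]; rewrite ltnS => nN.
by rewrite /= nN IH.
Qed.

Lemma expc0 b : expc b 0 = 1. Proof. by []. Qed.

Lemma expcS b n : n.+1%:R * expc b n.+1 = cauchyp b (expc b) n.
Proof.
rewrite {1}/expc /= ltnn mulVKf ?pnatr_eq0 //.
apply: eq_bigr => i _; congr (_ * _).
by rewrite expc_uptoE // leq_subr.
Qed.

(** The tool for recognising closed forms: Cauchy products, 1 - w and the binomial series are
    identified by checking the recursion. *)
Lemma expc_uniq b c : c 0%N = 1 ->
  (forall n, n.+1%:R * c n.+1 = cauchyp b c n) -> c =1 expc b.
Proof.
move=> c0 cS n; have [m] := ubnP n; elim: m n => // m IH [|n]; first by rewrite c0.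
rewrite ltnS => nm; apply: (@mulfI _ (n.+1%:R)); first by rewrite pnatr_eq0.
rewrite cS expcS; apply: eq_bigr => i _; congr (_ * _).
by rewrite IH // (leq_ltn_trans (leq_subr _ _)).
Qed.

Lemma eq_expc b b' : b =1 b' -> expc b =1 expc b'.
Proof.
move=> bb'; apply: expc_uniq => // n; rewrite expcS.
by apply: eq_bigr => i _; rewrite bb'.
Qed.

Lemma coefM_agree (p p' q : {poly R[i]}) n :
  (forall i, (i <= n)%N -> p`_i = p'`_i) -> (p * q)`_n = (p' * q)`_n.
Proof.
move=> pp'; rewrite !coefM; apply: eq_bigr => i _.
by rewrite pp' // -ltnS.
Qed.

(* The product of solutions of E' = b E and F' = b' F solves G' = (b + b') G. *)
Lemma expcD b b' : expc (fun n => b n + b' n) =1 cauchyp (expc b) (expc b').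
Proof.
move=> n; apply/esym; move: n; apply: expc_uniq.
  by rewrite /cauchyp big_ord1 mulr1.
(* Length n + 2, because coefficient n of a derivative sees coefficient n + 1; the differential
   equation survives this truncation up to degree n. *)
move=> n; pose P u := \poly_(i < n.+2) u i : {poly R[i]}.
have deriv_expc c i : (i <= n)%N -> (P (expc c))^`()`_i = (P c * P (expc c))`_i.
  move=> iin; rewrite coef_deriv coef_poly ltnS ltnS iin -mulr_natl expcS.
  by apply: cauchyp_poly; rewrite ltnS (leq_trans iin).
have -> : n.+1%:R * cauchyp (expc b) (expc b') n.+1 = (P (expc b) * P (expc b'))^`()`_n.
  by rewrite coef_deriv -(@cauchyp_poly _ _ n.+2) // mulr_natl.
rewrite derivM coefD (coefM_agree _ (deriv_expc b)).
rewrite (mulrC (P (expc b)) _^`()) (coefM_agree _ (deriv_expc b')).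
rewrite -coefD.
have -> : P b * P (expc b) * P (expc b') + P b' * P (expc b') * P (expc b) =
   P (fun n => b n + b' n) * (P (expc b) * P (expc b')).
  have -> : P (fun n => b n + b' n) = P b + P b'.
    by apply/polyP=> i; rewrite coefD !coef_poly; case: ifP; rewrite ?addr0.
  by ring.
rewrite mulrC (@cauchyp_poly _ _ n.+2) //.
rewrite (mulrC (\poly_(i < n.+2) (b i + b' i))); apply: coefM_agree => i iin.
rewrite coef_poly ltnS (leq_trans iin) //.
by rewrite -cauchyp_poly // ltnS (leq_trans iin).
Qed.

End CauchyProduct.

(** * Uniform bounds and first-order expansion of exponential coefficients *)

Section ExpcBound.
Variables (R : realType) (K r q : R).
Hypotheses (r0 : 0 <= r) (rq : r < q) (q1 : q < 1).
Hypothesis K0 : 0 <= K.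
Let K' := K / (q - r).

Let q0 : 0 < q. Proof. exact: le_lt_trans rq. Qed.
Let q01 : 0 <= q < 1. Proof. by rewrite ltW. Qed.
Let rq1 : 0 <= r / q < 1.
Proof. by rewrite divr_ge0 ?(ltW q0) //= ltr_pdivrMr // mul1r. Qed.

(** The convolution is at most A K q^n sum_k (r / q)^k, and K q^n / (1 - r / q) = K q^(n+1) / (q -
    r): this is the origin of [K']. *)
Lemma cauchyp_bound (b x : nat -> R[i]) A n : 0 <= A ->
    (forall k, cmod (b k) <= K * r ^+ k) ->
    (forall j, (j <= n)%N -> cmod (x j) <= A * q ^+ j) ->
  cmod (cauchyp b x n) <= A * K' * q ^+ n.+1.
Proof.
move=> A0 bK xA; rewrite (le_trans (cmod_sum _ _ _)) //.
apply: (@le_trans _ _ (\sum_(k < n.+1) A * K * q ^+ n * (r / q) ^+ k)).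
  apply: ler_sum => k _; have kn : (k <= n)%N by rewrite -ltnS.
  have qn : q ^+ n = q ^+ k * q ^+ (n - k) by rewrite -exprD subnKC.
  have -> : A * K * q ^+ n * (r / q) ^+ k = (K * r ^+ k) * (A * q ^+ (n - k)).
    have qk : q ^+ k != 0 by rewrite expf_neq0 ?gt_eqF.
    rewrite qn expr_div_n; move: (q ^+ (n - k)) (q ^+ k) qk => y z z0.
    by field.
  by rewrite cmodM ler_pM ?cmod_ge0 // xA // leq_subr.
rewrite -mulr_sumr exprS.
have -> : A * K' * (q * q ^+ n) = A * K * q ^+ n * (1 - r / q)^-1.
  rewrite /K'; field.
  by rewrite !gt_eqF // subr_gt0.
by rewrite ler_wpM2l ?sum_geo_le // !mulr_ge0 // exprn_ge0 // ltW.
Qed.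

Lemma ge0K' : 0 <= K'.
Proof.
by rewrite divr_ge0 // subr_ge0 ltW.
Qed.

(** A step of the recursion multiplies the running bound by K' / (n + 1), which is at most 1 once n
    + 1 exceeds [n0]; only the first [n0] steps can enlarge it. [M] is chosen before [b] so as to
    serve all z b with |z| <= 1 at once. *)
Lemma expc_bound : exists2 M, 0 <= M & forall b : nat -> R[i],
  (forall k, cmod (b k) <= K * r ^+ k) -> forall n, cmod (expc b n) <= M * q ^+ n.
Proof.
pose n0 := Num.bound K'; have Kn0 : K' <= n0%:R.
  by rewrite ltW // archi_boundP // ge0K'.
pose L := 1 + K'; have L1 : 1 <= L by rewrite lerDl ge0K'.
have L0 : 0 <= L by exact: le_trans L1.
exists (L ^+ n0); first exact: exprn_ge0.
move=> b bK n.
suff H : cmod (expc b n) <= L ^+ minn n n0 * q ^+ n.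
  rewrite (le_trans H) // ler_wpM2r ?exprn_ge0 ?(ltW q0) //.
  by rewrite ler_weXn2l // geq_minr.
have [m] := ubnP n; elim: m n => // m IH [|n]; first by rewrite expc0 cmod1 min0n expr0 mulr1.
rewrite ltnS => nm.
have n1 : 0 < n.+1%:R :> R by rewrite ltr0n.
rewrite -(ler_pM2l n1) -[X in X * cmod _]cmod_nat -cmodM expcS.
apply: (@le_trans _ _ (L ^+ minn n n0 * K' * q ^+ n.+1)).
  apply: cauchyp_bound => //; first exact: exprn_ge0.
  move=> j jn; apply: le_trans (IH j _) _; first exact: leq_ltn_trans nm.
  rewrite ler_wpM2r ?exprn_ge0 ?(ltW q0) // ler_weXn2l //.
  by rewrite leq_min geq_minr (leq_trans (geq_minl _ _)).
rewrite [leRHS]mulrA ler_wpM2r ?exprn_ge0 ?(ltW q0) //.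
have [nn0|nn0] := leqP n.+1 n0.
  rewrite (minn_idPl (ltnW nn0)) exprS [L * _]mulrC [leRHS]mulrCA.
  rewrite ler_wpM2l ?exprn_ge0 // -[K']mul1r ler_pM ?ge0K' //.
    by rewrite ler1n.
  by rewrite /L lerDr.
rewrite (minn_idPr _) // mulrC ler_wpM2r ?exprn_ge0 //.
by rewrite (le_trans Kn0) // ler_nat ltnW.
Qed.

Variable b : nat -> R[i].
Hypothesis bK : forall k, cmod (b k) <= K * r ^+ k.
Let S := csum (fun k => b k / k.+1%:R).

Lemma div_succ_bound k : cmod (b k / k.+1%:R) <= K * r ^+ k.
Proof.
rewrite cmodM cmodV cmod_nat (le_trans _ (bK k)) // ler_piMr ?cmod_ge0 //.
by rewrite invf_le1 ?ltr0n // ler1n.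
Qed.

(** The recursion is used twice: it gives c_(n+1) = O(z), and this estimate, put back into the
    convolution, gives c_(n+1) = z b_n / (n + 1) + O(z^2). *)
Lemma csum_expc_lin : exists2 C, 0 <= C & forall z : R[i], cmod z <= 1 ->
  cmod (csum (expc (fun k => z * b k)) - (1 + z * S)) <= C * cmod z ^+ 2.
Proof.
have [M M0 Mb] := expc_bound.
exists (M * K' ^+ 2 * q / (1 - q)).
  by rewrite !mulr_ge0 ?exprn_ge0 ?ge0K' ?invr_ge0 ?subr_ge0 // ltW.
move=> z z1; set c := expc _.
have zbK k : cmod (z * b k) <= K * r ^+ k.
  by rewrite cmodM (le_trans _ (bK k)) // ler_piMl ?cmod_ge0.
have cM : forall n, cmod (c n) <= M * q ^+ n by apply: Mb.
have shrink n (w : R[i]) : cmod w <= cmod (n.+1%:R * w).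
  by rewrite cmodM cmod_nat ler_peMl ?cmod_ge0 // ler1n.
have convz x n : cauchyp (fun k => z * b k) x n = z * cauchyp b x n.
  by rewrite /cauchyp mulr_sumr; apply: eq_bigr => i _; rewrite mulrA.
have c1 n : cmod (c n.+1) <= cmod z * M * K' * q ^+ n.+1.
  rewrite (le_trans (shrink n _)) // expcS convz cmodM.
  have -> : cmod z * M * K' * q ^+ n.+1 = cmod z * (M * K' * q ^+ n.+1) by ring.
  by rewrite ler_wpM2l ?cmod_ge0 // cauchyp_bound.
have P0 : 0 <= cmod z * M * K'.
  by apply: mulr_ge0 ge0K'; exact: mulr_ge0 (cmod_ge0 _) M0.
(* The summand b_n c_0 = b_n of the convolution is the linear term; with c_0 replaced by 0, only
   terms of order z remain. *)
pose c' n := if n is 0 then 0 else c n.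
have c'1 n : cmod (c' n) <= cmod z * M * K' * q ^+ n.
  case: n => [|n]; last exact: c1.
  by rewrite cmod0 expr0 mulr1 P0.
have c2 n : cmod (c n.+1 + (- z) * (b n / n.+1%:R)) <=
    M * K' ^+ 2 * q * cmod z ^+ 2 * q ^+ n.
  rewrite (le_trans (shrink n _)) //.
  have -> : n.+1%:R * (c n.+1 + - z * (b n / n.+1%:R)) = z * cauchyp b c' n.
    rewrite mulrDr expcS convz mulrCA [n.+1%:R * _]mulrC divfK ?pnatr_eq0 //.
    rewrite mulNr -mulrBr; congr (z * _).
    rewrite /cauchyp !big_ord_recr /= subnn mulr0 mulr1 addrK addr0.
    apply: eq_bigr => i _ /=; congr (_ * _).
    by have : (0 < n - i)%N; [rewrite subn_gt0 | case: (n - i)%N].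
  rewrite cmodM.
  apply: (@le_trans _ _ (cmod z * (cmod z * M * K' * K' * q ^+ n.+1))).
    rewrite ler_wpM2l ?cmod_ge0 // cauchyp_bound //.
  by rewrite exprS le_eqVlt; apply/orP; left; apply/eqP; ring.
pose M1 := M * q + K; have M10 : 0 <= M1 by rewrite addr_ge0 ?mulr_ge0 // ltW.
have e1 n : cmod (c n.+1) <= M1 * q ^+ n.
  rewrite (le_trans (cM _)) // exprS mulrA ler_wpM2r ?exprn_ge0 ?(ltW q0) //.
  by rewrite lerDl.
have e2' n : cmod (b n / n.+1%:R) <= K * q ^+ n.
  rewrite (le_trans (div_succ_bound n)) // ler_wpM2l //.
  by rewrite lerXn2r // ?nnegrE ltW.
have e2 n : cmod (- z * (b n / n.+1%:R)) <= M1 * q ^+ n.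
  rewrite cmodM cmodN (@le_trans _ _ (1 * (K * q ^+ n))) //.
    by rewrite ler_pM ?cmod_ge0.
  rewrite mul1r ler_wpM2r ?exprn_ge0 ?(ltW q0) // lerDr.
  by rewrite mulr_ge0 // ltW.
rewrite (csumS q01 cM) [c 0%N]expc0 opprD addrACA subrr add0r -mulNr.
rewrite -(csumZ _ q01 e2') -(csumD q01 e1 e2).
by rewrite mulrAC; exact: csum_le.
Qed.

End ExpcBound.

Lemma csum_expcX (R : realType) (K r : R) (b : nat -> R[i]) N :
    0 <= r < 1 -> 0 <= K -> (forall k, cmod (b k) <= K * r ^+ k) ->
  csum (expc (fun k => N.+1%:R * b k)) = csum (expc b) ^+ N.+1.
Proof.
move=> r01 K0 bK; elim: N => [|N IH].
  by rewrite expr1; congr csum; apply/funext; apply: eq_expc => k; rewrite mul1r.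
rewrite exprS -IH.
have [r0 _] := andP r01; have [q0 q1 rq _] := half_rate r01.
set q := (1 + r) / 2 in q0 q1 rq.
have NK0 : 0 <= N.+1%:R * K by rewrite mulr_ge0.
have [M1 M10 HM1] := expc_bound r0 rq K0.
have [M2 M20 HM2] := expc_bound r0 rq NK0.
rewrite -(@csum_cauchyp _ _ _ (M1 + M2) q) //.
- congr csum; apply/funext => n; rewrite -expcD; apply: eq_expc => k.
  by rewrite -[N.+2]add1n natrD mulrDl mul1r.
- by rewrite ltW.
- by move=> n; rewrite (le_trans (HM1 _ bK n)) // ler_wpM2r ?exprn_ge0 ?(ltW q0) // lerDl.
- move=> n; rewrite (le_trans (HM2 _ _ n)) // ?ler_wpM2r ?exprn_ge0 ?(ltW q0) ?lerDr //.
  by move=> k; rewrite cmodM cmod_nat -mulrA ler_wpM2l.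
Qed.

(** * The complex exponential *)

Section ComplexExp.
Variable R : realType.
Implicit Types (z w : R[i]).

Lemma cexpE z : cexp z =
  (expR (complex.Re z) * cos (complex.Im z)) +i* (expR (complex.Re z) * sin (complex.Im z)).
Proof. by rewrite /cexp; apply/eqP; rewrite eq_complex /= !mul0r subr0 addr0 !eqxx. Qed.

Lemma cexpD z w : cexp (z + w) = cexp z * cexp w.
Proof.
rewrite !cexpE ReD ImD expRD cosD sinD.
by apply/eqP; rewrite eq_complex /=; apply/andP; split; apply/eqP; ring.
Qed.

Lemma cexp0 : cexp (0 : R[i]) = 1.
Proof. by rewrite cexpE /= expR0 cos0 sin0 mulr1 mulr0. Qed.

Lemma cexpMn z n : cexp (z *+ n) = cexp z ^+ n.
Proof.
elim: n => [|n IH]; first by rewrite mulr0n cexp0.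
by rewrite mulrS cexpD IH exprS.
Qed.

Lemma cexp_sum (I : Type) (r : seq I) (P : pred I) (F : I -> R[i]) :
  cexp (\sum_(i <- r | P i) F i) = \prod_(i <- r | P i) cexp (F i).
Proof. exact: (big_morph _ cexpD cexp0). Qed.

Lemma cmod_cexp z : cmod (cexp z) = expR (complex.Re z).
Proof.
rewrite /cexp cmodM cmod_real ger0_norm ?expR_ge0 //.
by rewrite cmodEsqrt /= cos2Dsin2 sqrtr1 mulr1.
Qed.

Lemma cvg_slope0 (f : R -> R) (df : R) : is_derive (0 : R) 1 f df ->
  (fun n => n.+1%:R * (f n.+1%:R^-1 - f 0)) @ \oo --> df.
Proof.
move=> [fd <-]; have := fd; rewrite /derivable => /cvg_ex[l fl].
rewrite /derive (cvg_lim _ fl) //.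
move/cvgr_dnbhsP: fl => /(_ (fun n => n.+1%:R^-1)) H.
rewrite (_ : (fun n => n.+1%:R * _) =
    (fun n => n.+1%:R^-1^-1 *: (f (n.+1%:R^-1 *: 1 + 0) - f 0))).
  by apply: H; split; [move=> n; rewrite invr_eq0 pnatr_eq0 | exact: cvg_harmonic].
by apply/funext => n; rewrite invrK addr0 /GRing.scale /= mulr1.
Qed.

(** The real and imaginary parts of the exponential along the ray t z have derivatives Re z and Im z
    at t = 0; they are sampled at t = 1 / (n + 1). *)
Lemma cvg_cexp_slope z :
  (fun n => cmod (n.+1%:R * (cexp (z / n.+1%:R) - 1) - z)) @ \oo --> 0.
Proof.
case: z => x y.
have Hx : is_derive (0 : R) 1 (fun t => expR (t * x) * cos (t * y)) x.
  apply: is_derive_eq; rewrite !mul0r expR0 cos0 sin0 /GRing.scale /=; ring.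
have Hy : is_derive (0 : R) 1 (fun t => expR (t * x) * sin (t * y)) y.
  apply: is_derive_eq; rewrite !mul0r expR0 cos0 sin0 /GRing.scale /=; ring.
have := cvg_norm_sub (cvg_slope0 Hx); have := cvg_norm_sub (cvg_slope0 Hy).
move=> cy cx; have := cvgD cx cy; rewrite addr0; move=> /(_ _) H; apply: (cvg_squeeze0 _ H) => n.
rewrite cmod_ge0 /= (le_trans (cmod_le_ReIm _)) // cexpE.
have -> : (x +i* y) / n.+1%:R = (n.+1%:R^-1 * x) +i* (n.+1%:R^-1 * y) :> R[i].
  rewrite -(rmorph_nat (real_complex R)) -fmorphV /=.
  by apply/eqP; rewrite eq_complex /= !mulr0 subr0 add0r ![_ * (_)^-1]mulrC !eqxx.
rewrite -(rmorph_nat (real_complex R)) /= !mul0r expR0 cos0 sin0 !subr0 !addr0.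
by rewrite fctE mulr1 mulr0 subr0.
Qed.

Lemma cmod_subX z w (B : R) n : cmod z <= B -> cmod w <= B ->
  cmod (z ^+ n.+1 - w ^+ n.+1) <= n.+1%:R * B ^+ n * cmod (z - w).
Proof.
move=> zB wB; rewrite subrXX cmodM mulrC ler_wpM2r ?cmod_ge0 //.
rewrite (le_trans (cmod_sum _ _ _)) //.
rewrite -[n.+1 in X in X * _]card_ord mulr_natl -sumr_const; apply: ler_sum => i _.
have -> : B ^+ n = B ^+ (n - i) * B ^+ i by rewrite -exprD subnK // -ltnS.
by rewrite cmodM !cmodX /= ler_pM ?exprn_ge0 ?cmod_ge0 // lerXn2r // ?nnegrE ?cmod_ge0 //;
  apply: le_trans zB; exact: cmod_ge0.
Qed.

(* Since b = (n + 1) (b / (n + 1)), both sides are (n + 1)-st powers of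
   1 + S / (n + 1) + o(1 / n). *)
Lemma csum_expc (K r : R) (b : nat -> R[i]) : 0 <= r < 1 -> 0 <= K ->
    (forall k, cmod (b k) <= K * r ^+ k) ->
  csum (expc b) = cexp (csum (fun k => b k / k.+1%:R)).
Proof.
move=> r01 K0 bK; pose S := csum (fun k => b k / k.+1%:R); rewrite -/S.
have [r0 _] := andP r01; have [q0 q1 rq _] := half_rate r01.
have [C C0 HC] := csum_expc_lin r0 rq q1 K0 bK; rewrite -/S in HC.
pose phi (n : nat) := csum (expc (fun k => n.+1%:R^-1 * b k)).
have phiX n : csum (expc b) = phi n ^+ n.+1.
  rewrite -(@csum_expcX _ K r) //.
    congr csum; apply/funext; apply: eq_expc => k.
    by rewrite mulVKf ?pnatr_eq0.
  move=> k; rewrite cmodM cmodV cmod_nat (le_trans _ (bK k)) //.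
  by rewrite ler_piMl ?cmod_ge0 // invf_le1 ?ltr0n // ler1n.
pose psi (n : nat) := cexp (S / n.+1%:R).
have psiX n : cexp S = psi n ^+ n.+1.
  by rewrite /psi -cexpMn -mulrnAr -mulr_natl mulfV ?pnatr_eq0 // mulr1.
(* Chosen so that exp (B / (n + 1)) dominates both bases; its n-th power stays below exp B, and the
   factor n + 1 from [cmod_subX] is absorbed by phi - psi = o(1 / n). *)
pose B := C + cmod S.
have phi_lin n : cmod (phi n - (1 + S / n.+1%:R)) <= C / n.+1%:R ^+ 2.
  have := HC n.+1%:R^-1; rewrite cmodV cmod_nat [_^-1 * _]mulrC exprVn; apply.
  by rewrite invf_le1 ?ltr0n // ler1n.
have n1 n : 0 < n.+1%:R :> R by rewrite ltr0n.
have phiB n : cmod (phi n) <= expR (B / n.+1%:R).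
  apply: le_trans (expR_ge1Dx _).
  rewrite -[phi n](subrK (1 + S / n.+1%:R)) (le_trans (cmodD _ _)) //.
  rewrite /B mulrDl addrCA lerD //.
    rewrite (le_trans (phi_lin n)) // ler_wpM2l // lef_pV2 ?posrE ?exprn_gt0 //.
    by rewrite ler_eXnr // ler1n.
  by rewrite (le_trans (cmodD _ _)) // cmod1 cmodM cmodV cmod_nat.
have psiB n : cmod (psi n) <= expR (B / n.+1%:R).
  rewrite cmod_cexp ler_expR.
  rewrite (le_trans (ler_norm _)) // (le_trans (Re_le_cmod _)) //.
  by rewrite cmodM cmodV cmod_nat ler_wpM2r ?invr_ge0 // lerDr.
have bound n : cmod (csum (expc b) - cexp S) <= expR B *
    (C * n.+1%:R^-1 + cmod (n.+1%:R * (cexp (S / n.+1%:R) - 1) - S)).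
  rewrite (phiX n) (psiX n) (le_trans (cmod_subX _ (phiB n) (psiB n))) //.
  rewrite mulrAC mulrC; apply: ler_pM.
  - by rewrite exprn_ge0 // expR_ge0.
  - by rewrite mulr_ge0 // cmod_ge0.
  - rewrite -expRM_natl ler_expR mulrCA ler_piMr //.
      by rewrite addr_ge0 // cmod_ge0.
    by rewrite ler_pdivrMr // mul1r ler_nat.
  rewrite -[X in X * _]cmod_nat -cmodM.
  have -> : n.+1%:R * (phi n - psi n) = n.+1%:R * (phi n - (1 + S / n.+1%:R)) -
      (n.+1%:R * (psi n - 1) - S).
    have : n.+1%:R != 0 :> R[i] by rewrite pnatr_eq0.
    by move: (phi n) (psi n) => a c h; field.
  rewrite (le_trans (cmodBD _ _)) // lerD2r cmodM cmod_nat.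
  apply: (@le_trans _ _ (n.+1%:R * (C / n.+1%:R ^+ 2))).
    by rewrite ler_wpM2l.
  rewrite le_eqVlt; apply/orP; left; apply/eqP; field.
  by rewrite nat1r pnatr_eq0.
apply/eqP; rewrite -subr_eq0 -cmod_eq0 eq_le cmod_ge0 andbT.
suff H : (fun n => expR B *
    (C * n.+1%:R^-1 + cmod (n.+1%:R * (cexp (S / n.+1%:R) - 1) - S))) @ \oo --> 0.
  by apply: cvgr_to_ge H _; near=> n; exact: bound.
rewrite -(mulr0 (expR B)); apply: cvgM; first exact: cvg_cst.
rewrite -[0 in X in _ --> X]addr0; apply: cvgD; last exact: cvg_cexp_slope.
rewrite -(mulr0 C); apply: cvgM; first exact: cvg_cst.
exact: cvg_harmonic.
Unshelve. all: by end_near. Qed.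

End ComplexExp.

(** * Logarithm and binomial series *)

Section LogBinomial.
Variable R : realType.
Implicit Types (z w s : R[i]).

(** On ]-pi, pi[ the sign of sin (Im z) is that of Im z, so the test in [carg] selects the right
    inverse of the cosine. *)
Lemma clnK z : - pi < complex.Im z < pi -> cln (cexp z) = z.
Proof.
move=> /andP[zl zr].
have e0 : 0 < expR (complex.Re z) :> R by exact: expR_gt0.
rewrite /cln cmod_cexp expRK /carg cmod_cexp cexpE /=.
rewrite [expR _ * cos _]mulrC mulfK ?gt_eqF // pmulr_rge0 //.
case: z zl zr {e0} => x y /= yl yr; congr (_ +i* _).
have [y0|y0] := leP 0 y.
  rewrite ifT ?cosK ?in_itv /= ?y0 ?(ltW yr) //.
  by rewrite sin_ge0_pi // y0 ltW.
rewrite ifF.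
  by rewrite cosKN ?opprK // (ltW y0) ltW.
apply/negbTE; rewrite -ltNge -oppr_gt0 -sinN sin_gt0_pi // oppr_gt0 y0 /=.
by rewrite ltrNl.
Qed.

Lemma csum0 : csum (fun=> 0 : R[i]) = 0.
Proof.
apply/eqP; rewrite -cmod_eq0 eq_le cmod_ge0 andbT.
rewrite -(mul0r ((1 : R) - 0)^-1); apply: csum_le => [|n].
  by rewrite lexx ltr01.
by rewrite cmod0 mul0r.
Qed.

(** The power series of log (1 - w). *)
Definition clog1 w : R[i] := csum (fun k => - w ^+ k.+1 / k.+1%:R).

Lemma cexp_clog1 w : cmod w < 1 -> cexp (clog1 w) = 1 - w.
Proof.
move=> w1; have w01 : 0 <= cmod w < 1 by rewrite cmod_ge0.
rewrite -(@csum_expc _ (cmod w) (cmod w)) ?cmod_ge0 //; last first.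
  by move=> k; rewrite cmodN cmodX exprS.
(* The coefficients of 1 - w t, which is exp (- sum_m w^m t^m / m). *)
pose c (n : nat) : R[i] := if n is n'.+1 then (if n' is 0 then - w else 0) else 1.
have -> : expc (fun k => - w ^+ k.+1) = c.
  apply/esym/funext; apply: expc_uniq => // -[|n].
    by rewrite /cauchyp big_ord1 /= expr1 mul1r mulr1.
  rewrite /cauchyp !big_ord_recr /= subnn subSnn big1 ?add0r.
    by rewrite mulr0 !mulNr mulrN opprK mulr1 -exprSr subrr.
  move=> i _ /=; rewrite subSn; last exact: ltnW.
  by rewrite -(prednK (n := (n - i)%N)) ?subn_gt0 //= mulr0.
have h01 : 0 <= (2^-1 : R) < 1 by lra.
(* Any rate suits a finite support; at rate 1/2 the constant 2 covers c_0 = 1 and |c_1| < 1. *)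
have cM n : cmod (c n) <= 2 * 2^-1 ^+ n.
  case: n => [|[|n]] /=; first by rewrite cmod1; lra.
    by rewrite cmodN expr1; lra.
  by rewrite cmod0 mulr_ge0 ?exprn_ge0 ?invr_ge0.
have cM' n : cmod (c n.+1) <= 1 * 2^-1 ^+ n.
  by rewrite (le_trans (cM _)) // exprS mulrA mulfV.
rewrite (csumS h01 cM) (csumS h01 cM') /=.
by rewrite csum0 addr0.
Qed.

(** Termwise, the factor n + 1 in |z^(n+1) - w^(n+1)| <= (n + 1) B^n |z - w| cancels the denominator
    and leaves a geometric series. Both the size of [clog1] and its continuity along segments
    follow. *)
Lemma clog1_lipschitz z w (B : R) : cmod z <= B -> cmod w <= B -> B < 1 ->
  cmod (clog1 z - clog1 w) <= cmod (z - w) / (1 - B).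
Proof.
move=> zB wB B1; have B0 : 0 <= B by exact: (le_trans (cmod_ge0 z)).
have B01 : 0 <= B < 1 by rewrite B0.
have term u n : cmod u <= B -> cmod (- u ^+ n.+1 / n.+1%:R) <= 1 * B ^+ n.
  move=> uB; rewrite mul1r cmodM cmodN cmodX cmodV cmod_nat.
  rewrite (@le_trans _ _ (cmod u ^+ n.+1)) //.
    by rewrite ler_piMr ?exprn_ge0 ?cmod_ge0 // invf_le1 ?ltr0n // ler1n.
  rewrite exprSr; apply: (@le_trans _ _ (B ^+ n * 1)); last by rewrite mulr1.
  apply: ler_pM; rewrite ?exprn_ge0 ?cmod_ge0 //.
    by rewrite lerXn2r // ?nnegrE ?cmod_ge0.
  by rewrite (le_trans uB) // ltW.
have zt n := term z n zB; have wt n := term w n wB.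
rewrite -[clog1 w]mul1r -mulNr -(csumZ _ B01 wt).
rewrite -(csumD B01 zt); last first.
  by move=> n; rewrite mulN1r cmodN.
apply: csum_le => // n.
rewrite mulN1r -mulrBl opprK addrC cmodM cmodV cmod_nat.
rewrite ler_pdivrMr ?ltr0n // mulrC mulrA.
by rewrite mulrAC (cmodB z); exact: cmod_subX.
Qed.

Lemma clog10 : clog1 0 = 0.
Proof.
rewrite -[RHS]csum0; congr csum; apply/funext => k.
by rewrite exprS mul0r oppr0 mul0r.
Qed.

Lemma cmod_clog1 w : cmod w < 1 -> cmod (clog1 w) <= cmod w / (1 - cmod w).
Proof.
move=> w1; have := @clog1_lipschitz w 0 (cmod w).
by rewrite clog10 !subr0 cmod0 cmod_ge0 => ->.
Qed.

Lemma Re_pos_cos z : 0 < complex.Re (cexp z) -> 0 < cos (complex.Im z).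
Proof. by rewrite cexpE /= pmulr_rgt0 // expR_gt0. Qed.

(** Along the segment t w, the real part of 1 - t w stays positive, so the cosine of the imaginary
    part of the logarithm never vanishes; starting at 0, that imaginary part cannot reach pi / 2 or
    - pi / 2. This fixes the branch, which exponentials alone leave open. *)
Lemma Im_clog1 w : cmod w < 1 -> - (pi / 2) < complex.Im (clog1 w) < pi / 2.
Proof.
move=> w1; pose g (t : R) := complex.Im (clog1 (t%:C * w)).
have tw (t : R) : 0 <= t <= 1 -> cmod (t%:C * w) <= cmod w.
  move=> /andP[t0 t1]; rewrite cmodM cmod_real ger0_norm //.
  by rewrite ler_piMl ?cmod_ge0.
have cosg (t : R) : 0 <= t <= 1 -> 0 < cos (g t).
  move=> t01; apply: Re_pos_cos.
  have tw1 : cmod (t%:C * w) < 1 by exact: le_lt_trans (tw _ t01) w1.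
  rewrite cexp_clog1 // ReB subr_gt0 /=.
  by rewrite (le_lt_trans _ tw1) // (le_trans (ler_norm _)) // Re_le_cmod.
have gc : {within `[0, 1], continuous g}.
  apply/subspace_continuousP => x; rewrite /= in_itv /= => x01.
  apply/cvgrPdist_lt => e e0; rewrite near_withinE.
  have d0 : 0 < e * (1 - cmod w) by rewrite mulr_gt0 // subr_gt0.
  near=> t => /=; rewrite in_itv /= => t01.
  rewrite -ImB (le_lt_trans (Im_le_cmod _)) //.
  rewrite (le_lt_trans (clog1_lipschitz (tw _ x01) (tw _ t01) w1)) //.
  rewrite ltr_pdivrMr ?subr_gt0 // -mulrBl -rmorphB /= cmodM cmod_real.
  apply: (@le_lt_trans _ _ `|x - t|).
    by rewrite ler_piMr // ltW.
  by near: t; apply: cvgr_dist_lt => //; exact: cvg_id.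
have g0 : g 0 = 0 by rewrite /g mul0r clog10.
have g1 : g 1 = complex.Im (clog1 w) by rewrite /g mul1r.
have noval (v : R) : cos v = 0 -> Num.min (g 0) (g 1) <= v <= Num.max (g 0) (g 1) -> False.
  move=> cv /(IVT ler01 gc)[c]; rewrite in_itv /= => c01 gcv.
  by have := cosg _ c01; rewrite gcv cv ltxx.
have pi2 : 0 < (pi / 2 : R) by rewrite divr_gt0 ?pi_gt0.
rewrite -g1; apply/andP; split; rewrite ltNge; apply/negP => gv.
  apply: (noval (- (pi / 2))); first by rewrite cosN cos_pihalf.
  by rewrite g0 ge_min le_max gv orbT /= oppr_le0 ltW.
apply: (noval (pi / 2)); first by rewrite cos_pihalf.
by rewrite g0 ge_min le_max gv orbT (ltW pi2).
Unshelve. all: by end_near. Qed.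

Lemma cln_1sub w : cmod w < 1 -> cln (1 - w) = clog1 w.
Proof.
move=> w1; rewrite -cexp_clog1 // clnK //.
have /andP[l r] := Im_clog1 w1; have p0 := pi_gt0 R.
by apply/andP; split; lra.
Qed.

Lemma cbinomS s n : cbinom s n.+1 = cbinom s n * ((s - n%:R) / n.+1%:R).
Proof.
rewrite /cbinom big_nat_recr //=; congr (_ * (_ / _)).
by rewrite -[n.+1%:R]nat1r opprD addrA addrAC addrNK.
Qed.

Lemma expc_binom s w n :
  expc (fun k => - s * w ^+ k.+1) n = cbinom s n * (-1) ^+ n * w ^+ n.
Proof.
apply/esym; move: n.
apply: (@expc_uniq _ _ (fun n => cbinom s n * (-1) ^+ n * w ^+ n)) => /=.
  by rewrite /cbinom big_nil !expr0 !mul1r.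
set c := fun n => cbinom s n * (-1) ^+ n * w ^+ n.
have cS n : n.+1%:R * c n.+1 = (n%:R - s) * w * c n.
  rewrite /c cbinomS !exprS; have : n.+1%:R != 0 :> R[i] by rewrite pnatr_eq0.
  by move: (n.+1%:R) => y y0; field.
elim=> [|n IH].
  by rewrite cS /cauchyp big_ord1 /= expr1 sub0r.
rewrite cS /cauchyp big_ord_recl subn0 /=.
(* The coefficients [- s * w ^+ k.+1] are geometric: without its first term, the convolution is [w]
   times the preceding one. *)
have -> : \sum_(i < n.+1) - s * w ^+ (bump 0 i).+1 * c (n.+1 - bump 0 i)%N =
    w * cauchyp (fun k => - s * w ^+ k.+1) c n.
  rewrite /cauchyp mulr_sumr; apply: eq_bigr => i _.
  by rewrite /bump /= add1n subSS exprS; ring.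
rewrite -IH expr1; rewrite -/(c n.+1); move: (c n.+1) => y; ring.
Qed.

Lemma cmod_binom_coef s (r : R) k : 0 <= r < 1 ->
  cmod (- s * r%:C ^+ k.+1) <= cmod s * r ^+ k.
Proof.
move=> /andP[r0 r1]; rewrite cmodM cmodN cmodX cmod_real ger0_norm //.
by rewrite ler_wpM2l ?cmod_ge0 // exprS ler_piMl ?exprn_ge0 // ltW.
Qed.

(** [expc_binom] at w = r makes these numbers exponential coefficients, to which [expc_bound]
    applies. *)
Lemma cbinom_bound s (r q : R) : 0 <= r -> r < q -> q < 1 ->
  exists2 M, 0 <= M & forall n, cmod (cbinom s n) * r ^+ n <= M * q ^+ n.
Proof.
move=> r0 rq q1; have [M M0 HM] := expc_bound r0 rq (cmod_ge0 s).
exists M => // n.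
have r01 : 0 <= r < 1 by rewrite r0 (lt_trans rq).
have := HM _ (fun k => cmod_binom_coef s k r01) n.
rewrite expc_binom !cmodM !cmodX cmodN cmod1 expr1n mulr1.
by rewrite cmod_real ger0_norm.
Qed.

Lemma csum_binom s w : cmod w < 1 ->
  csum (fun n => cbinom s n * (-1) ^+ n * w ^+ n) = cpow (1 - w) s.
Proof.
move=> w1; rewrite /cpow cln_1sub //.
have -> : (fun n => cbinom s n * (-1) ^+ n * w ^+ n) = expc (fun k => - s * w ^+ k.+1).
  by apply/funext => n; rewrite expc_binom.
have w01 : 0 <= cmod w < 1 by rewrite cmod_ge0.
have bK k : cmod (w ^+ k.+1) <= 1 * cmod w ^+ k.
  by rewrite mul1r cmodX exprS ler_piMl ?exprn_ge0 ?cmod_ge0 // ltW.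
rewrite (@csum_expc _ (cmod s) (cmod w)) ?cmod_ge0 //; last first.
  by move=> k; rewrite cmodM cmodN ler_wpM2l ?cmod_ge0 // -[leRHS]mul1r.
rewrite /clog1 -(@csumZ _ _ _ 1 (cmod w)) //.
  by congr (cexp (csum _)); apply/funext => k; rewrite !mulNr mulrN mulrA.
move=> k; rewrite cmodM cmodN cmodV cmod_nat (le_trans _ (bK k)) //.
by rewrite ler_piMr ?cmod_ge0 // invf_le1 ?ltr0n // ler1n.
Qed.

End LogBinomial.

(** * Infinite products over multi-indices *)

Section CexpContinuity.
Variable R : realType.

(** Write e^z - 1 as a difference of (n + 1)-st powers of e^(z / (n + 1)) and 1, bound it by
    [cmod_subX], and let n grow. *)
Lemma cmod_cexp_sub1 (z : R[i]) : cmod (cexp z - 1) <= cmod z * expR (cmod z).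
Proof.
have bound n : cmod (cexp z - 1) - expR (cmod z) * cmod z <= expR (cmod z) *
    cmod (n.+1%:R * (cexp (z / n.+1%:R) - 1) - z).
  set y := z / n.+1%:R.
  have n0 : n.+1%:R != 0 :> R[i] by rewrite pnatr_eq0.
  have zE : cexp z = cexp y ^+ n.+1.
    by rewrite -cexpMn /y -mulrnAr -mulr_natl mulfV // mulr1.
  have yB : cmod (cexp y) <= expR (cmod y).
    by rewrite cmod_cexp ler_expR (le_trans (ler_norm _)) // Re_le_cmod.
  have oB : cmod (1 : R[i]) <= expR (cmod y).
    by rewrite cmod1 -expR0 ler_expR cmod_ge0.
  have := cmod_subX n yB oB; rewrite -zE expr1n => H.
  rewrite lerBlDr -mulrDr (le_trans H) // mulrAC mulrC.
  apply: ler_pM.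
  - by rewrite exprn_ge0 // expR_ge0.
  - by rewrite mulr_ge0 // cmod_ge0.
  - rewrite -expRM_natl ler_expR /y cmodM cmodV cmod_nat mulrCA ler_piMr ?cmod_ge0 //.
    by rewrite ler_pdivrMr ?ltr0n // mul1r ler_nat.
  rewrite -[X in X * _]cmod_nat -cmodM.
  by rewrite -[in leLHS](subrK z (n.+1%:R * _)) cmodD.
rewrite [leRHS]mulrC -subr_le0.
have H : (fun n => expR (cmod z) * cmod (n.+1%:R * (cexp (z / n.+1%:R) - 1) - z))
    @ \oo --> 0.
  rewrite -(mulr0 (expR (cmod z))); apply: cvgM; first exact: cvg_cst.
  exact: cvg_cexp_slope.
by apply: cvgr_to_ge H _; near=> n; exact: bound.
Unshelve. all: by end_near. Qed.

Lemma cvg_cexp (T : Type) (F : set_system T) (FF : Filter F)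
    (f : T -> R[i]) (l : R[i]) :
  (f : T -> R[i]^o) @ F --> (l : R[i]^o) ->
  ((fun t => cexp (f t)) : T -> R[i]^o) @ F --> (cexp l : R[i]^o).
Proof.
move=> /cvg_cmodP fl; apply/cvg_cmodP.
apply: (@squeeze_cvgr _ _ _ _ (fun=> 0)
  (fun t => cmod (cexp l) * (cmod (f t - l) * expR (cmod (f t - l))))).
- near=> t; rewrite cmod_ge0 /=.
  have -> : cexp (f t) - cexp l = cexp l * (cexp (f t - l) - 1).
    by rewrite mulrBr mulr1 -cexpD (addrC l) subrK.
  by rewrite cmodM ler_wpM2l ?cmod_ge0 // cmod_cexp_sub1.
- exact: cvg_cst.
- rewrite -[0 in X in _ --> X](mulr0 (cmod (cexp l))).
  apply: cvgM; first exact: cvg_cst.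
  rewrite -[0 in X in _ --> X](mul0r (expR 0)); apply: cvgM => //.
  by apply: (cvg_comp _ _ fl); exact: continuous_expR.
Unshelve. all: by end_near. Qed.

End CexpContinuity.

Section Boxes.
Variable p : nat.
Local Notation index := {ffun 'I_p -> nat}.
Local Open Scope fset_scope.

Definition of_box N (h : {ffun 'I_p -> 'I_N}) : index := [ffun j => h j : nat].

Definition kbox N : {fset index} := [fset of_box h | h in {ffun 'I_p -> 'I_N}].

Lemma of_box_inj N : injective (@of_box N).
Proof.
move=> h h' /ffunP hh'; apply/ffunP => j; apply/val_inj.
by have := hh' j; rewrite !ffunE.
Qed.

Lemma mem_kbox N (k : index) : (k \in kbox N) = [forall j, (k j < N)%N].
Proof.
apply/imfsetP/forallP => [[h _ ->] j|kN]; first by rewrite ffunE.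
exists [ffun j => Ordinal (kN j)] => //.
by apply/ffunP => j; rewrite !ffunE.
Qed.

Lemma sub_kbox (A : {fset index}) : exists N, A `<=` kbox N.
Proof.
exists (\sum_(k <- A) \sum_(j < p) k j).+1; apply/fsubsetP => k kA.
rewrite mem_kbox; apply/forallP => j; rewrite ltnS.
rewrite (big_rem k) //= (leq_trans _ (leq_addr _ _)) //.
by rewrite (bigD1 j) //= leq_addr.
Qed.

(** Distributivity, through which a product of truncated series becomes one finite sum over
    multi-indices. *)
Lemma sum_kbox (V : comPzSemiRingType) (F : 'I_p -> nat -> V) N :
  (\sum_(k <- kbox N) \prod_(j < p) F j (k j) =
   \prod_(j < p) \sum_(n < N) F j n)%R.
Proof.
rewrite /kbox big_imfset /=; last by move=> ? ? _ _; exact: of_box_inj.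
rewrite bigA_distr_bigA big_enum /=.
by apply: eq_bigr => h _; apply: eq_bigr => j _; rewrite ffunE.
Qed.

End Boxes.

Section InfProd.
Variables (R : realType) (p : nat) (q : R).
Hypotheses (q0 : 0 <= q) (q1 : q < 1).
Local Notation index := {ffun 'I_p -> nat}.

Let weight (k : index) : R := \prod_(j < p) q ^+ k j.
Let total : R := (1 - q)^-1 ^+ p.

Let weight_ge0 k : 0 <= weight k.
Proof. by apply: prodr_ge0 => j _; exact: exprn_ge0. Qed.

Let sum_weight_kbox N : \sum_(k <- kbox p N) weight k = (\sum_(n < N) q ^+ n) ^+ p.
Proof.
by rewrite (sum_kbox (fun _ n => q ^+ n)) prodr_const card_ord.
Qed.

Let sum_weight_le (A : {fset index}) : \sum_(k <- A) weight k <= total.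
Proof.
have [N AN] := sub_kbox A.
apply: (@le_trans _ _ (\sum_(k <- kbox p N) weight k)).
  rewrite [leRHS](big_fsetIDcond _ (mem A)) /= -[leLHS]addr0 lerD //; last first.
    by apply: sumr_ge0 => k _.
  rewrite le_eqVlt; apply/orP; left; apply/eqP; apply: eq_fbigl => k.
  by rewrite !inE; apply/idP/andP => [kA|[]//]; rewrite (fsubsetP AN).
rewrite sum_weight_kbox; apply: lerXn2r; rewrite ?nnegrE.
- by apply: sumr_ge0 => i _; exact: exprn_ge0.
- by rewrite invr_ge0 subr_ge0 ltW.
- by rewrite sum_geo_le // q0.
Qed.

Let cvg_weight : (fun N => \sum_(k <- kbox p N) weight k) @ \oo --> total.
Proof.
rewrite (_ : (fun N => _) = (fun N => (\sum_(n < N) q ^+ n) ^+ p)); last first.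
  by apply/funext => N; rewrite sum_weight_kbox.
apply: (@cvg_comp _ _ _ (fun N => \sum_(n < N) q ^+ n) (fun y : R => y ^+ p)
  _ (nbhs (1 - q)^-1)); last exact: exprn_continuous.
have := @cvg_geometric_series R 1 q; rewrite ger0_norm // mul1r => /(_ q1).
rewrite (_ : series _ = (fun N => \sum_(n < N) q ^+ n)) //.
by apply/funext => N; rewrite /series /= big_mkord; apply: eq_bigr => i _; rewrite mul1r.
Qed.

Variables (v F : index -> R[i]) (D : R) (B : R[i]).
Hypothesis vD : forall k, cmod (v k) <= D * weight k.
Hypothesis v0 : v [ffun=> 0%N] = 0.
Hypothesis FE : forall k, k <> [ffun=> 0%N] -> F k = cexp (v k).
Hypothesis vB :
  ((fun N => \sum_(k <- kbox p N) v k) : nat -> R[i]^o) @ \oo --> (B : R[i]^o).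

Let D0 : 0 <= D.
Proof.
have := le_trans (cmod_ge0 _) (vD [ffun=> 0%N]).
rewrite /weight (eq_bigr (fun=> 1)) => [|j _]; last by rewrite ffunE expr0.
by rewrite big1_eq mulr1.
Qed.

Let weight_le1 k : weight k <= 1.
Proof.
by apply: prodr_ile1 => j _; rewrite exprn_ge0 //= exprn_ile1 // ltW.
Qed.

(** Convergence along boxes suffices because [weight] dominates [v]: for a finite set containing the
    box of side N, the sum of [v] differs from that over the box by at most [D] times the weight
    outside the box, which tends to 0. *)
Lemma has_infprod_kbox :
  has_infprod [set k : index | k <> [ffun=> 0%N]] F (cexp B).
Proof.
split.
  apply: (@le_lt_trans _ _ ((D * expR D) * total)%:E); last exact: ltry.
  apply: ub_ereal_sup => _ [X [finX XD] <-].
  rewrite fsbig_finite //=.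
  apply: (@le_trans _ _ (\sum_(k <- fset_set X) ((D * expR D) * weight k)%:E)%E).
    rewrite !big_seq; apply: lee_sum => k; rewrite in_fset_set // inE => Xk.
    rewrite ger0_norm ?cmod_ge0 // lee_fin FE; last exact: XD.
    rewrite (le_trans (cmod_cexp_sub1 _)) // mulrAC.
    apply: ler_pM; rewrite ?cmod_ge0 ?expR_ge0 //.
    by rewrite ler_expR (le_trans (vD _)) // ler_piMr.
  rewrite sumEFin lee_fin -mulr_sumr ler_wpM2l //.
  by rewrite mulr_ge0 // expR_ge0.
(* As [v] vanishes at the zero index, a finite set may contain it without changing the sum. *)
have -> : (fun A : {fset index} =>
    (\prod_(i <- A | i \in [set k : index | k <> [ffun=> 0%N]]) F i : R[i]^o)) =
    (fun A => cexp (\sum_(i <- A) v i)).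
  apply/funext => A; rewrite cexp_sum [RHS](bigID (mem [set k : index | k <> [ffun=> 0%N]])) /=.
  rewrite [X in _ = _ * X]big1 ?mulr1 => [|k].
    by apply: eq_bigr => k; rewrite inE => /FE.
  by rewrite notin_setE /= => /contrapT ->; rewrite v0 cexp0.
have FF : Filter (@summability.totally index).
  exact: (@filter_filter _ _ summability.totally_filter).
apply: cvg_cexp; apply/cvg_cmodP.
apply/cvgrPdist_lt => e e0.
pose err N := cmod (\sum_(k <- kbox p N) v k - B) +
  D * (total - \sum_(k <- kbox p N) weight k).
have : err @ \oo --> 0.
  rewrite -[0 in X in _ --> X]addr0; apply: cvgD; first exact/cvg_cmodP.
  rewrite -[0 in X in _ --> X](mulr0 D); apply: cvgM; first exact: cvg_cst.
  by rewrite -[0 in X in _ --> X](subrr total); apply: cvgB; [exact: cvg_cst|exact: cvg_weight].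
move/cvgrPdist_lt => /(_ _ e0)[N _ /(_ N)]; rewrite /= leqnn => /(_ isT) HN.
exists (kbox p N) => // A /= NA.
rewrite sub0r normrN ger0_norm ?cmod_ge0 //; apply: le_lt_trans HN.
rewrite sub0r normrN; apply: le_trans (ler_norm _).
have split_sum (V : nmodType) (f : index -> V) : (\sum_(k <- A) f k =
    \sum_(k <- kbox p N) f k + \sum_(k <- A | k \notin kbox p N) f k).
  rewrite (bigID (mem (kbox p N))) /=; congr (_ + _).
  rewrite big_fset_condE; apply: eq_fbigl => k.
  by rewrite !inE /=; apply/andP/idP => [[]//|kN]; rewrite (fsubsetP NA).
rewrite split_sum addrAC (le_trans (cmodD _ _)) // lerD2l.
apply: (@le_trans _ _ (D * \sum_(k <- A | k \notin kbox p N) weight k)).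
  by rewrite mulr_sumr (le_trans (cmod_sum _ _ _)) // ler_sum.
by rewrite ler_wpM2l // lerBrDl -split_sum.
Qed.

End InfProd.

(** * Expectation over the symmetric group *)

Section MoreSeries.
Variable R : realType.

Lemma csumB (u v : nat -> R[i]) (M r : R) : 0 <= r < 1 ->
  (forall n, cmod (u n) <= M * r ^+ n) -> (forall n, cmod (v n) <= M * r ^+ n) ->
  csum (fun n => u n - v n) = csum u - csum v.
Proof.
move=> r01 uM vM; rewrite -[csum v]mul1r -mulNr -(csumZ _ r01 vM) -(csumD r01 uM).
  by congr csum; apply/funext => n; rewrite mulN1r.
by move=> n; rewrite mulN1r cmodN.
Qed.

Lemma csum_sum (I : Type) (A : seq I) (u : I -> nat -> R[i]) (M : I -> R) (r : R) :
  0 <= r < 1 -> (forall i n, cmod (u i n) <= M i * r ^+ n) ->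
  csum (fun n => \sum_(i <- A) u i n) = \sum_(i <- A) csum (u i).
Proof.
move=> r01 uM; have [r0 _] := andP r01.
have M0 i : 0 <= M i.
  by have := uM i 0%N; rewrite expr0 mulr1; apply: le_trans; exact: cmod_ge0.
elim: A => [|i A IH].
  rewrite big_nil -[RHS](csum0 R); congr csum; apply/funext => n.
  by rewrite big_nil.
have sA0 : 0 <= \sum_(j <- A) M j by apply: sumr_ge0.
rewrite big_cons -IH -(@csumD _ _ _ (M i + \sum_(j <- A) M j) r) //.
- by congr csum; apply/funext => n; rewrite big_cons.
- by move=> n; rewrite (le_trans (uM i n)) // ler_wpM2r ?exprn_ge0 // lerDl.
move=> n; rewrite (le_trans (cmod_sum _ _ _)) //.
apply: (@le_trans _ _ (\sum_(j <- A) M j * r ^+ n)).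
  by apply: ler_sum => j _; exact: uM.
by rewrite -mulr_suml ler_wpM2r ?exprn_ge0 // lerDr.
Qed.

(** Exchange the factors one at a time; [1 <= L] lets one power of [L] bound all partial
    products. *)
Lemma cmod_prod_sub (I : Type) (A : seq I) (f g : I -> R[i]) (L d : R) :
    1 <= L -> 0 <= d -> (forall i, cmod (f i) <= L) ->
    (forall i, cmod (g i) <= L) -> (forall i, cmod (f i - g i) <= d) ->
  cmod (\prod_(i <- A) f i - \prod_(i <- A) g i) <= (size A)%:R * L ^+ size A * d.
Proof.
move=> L1 d0 fL gL fg; have L0 : 0 <= L by exact: le_trans L1.
have prodL (h : I -> R[i]) B : (forall i, cmod (h i) <= L) ->
    cmod (\prod_(i <- B) h i) <= L ^+ size B.
  move=> hL; elim: B => [|i B IH]; first by rewrite big_nil cmod1.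
  by rewrite big_cons cmodM exprS ler_pM ?cmod_ge0.
elim: A => [|i A IH]; first by rewrite !big_nil subrr cmod0 !mul0r.
rewrite !big_cons; set F := \prod_(_ <- _) _ in IH *; set G := \prod_(_ <- _) _ in IH *.
have -> : f i * F - g i * G = (f i - g i) * F + g i * (F - G) by ring.
rewrite (le_trans (cmodD _ _)) // !cmodM.
apply: (@le_trans _ _ (d * L ^+ size A + L * ((size A)%:R * L ^+ size A * d))).
  by rewrite lerD // ler_pM ?cmod_ge0 // prodL.
rewrite /= -[(size A).+1%:R]nat1r !mulrDl mul1r exprS lerD //.
  by rewrite mulrC ler_wpM2r // ler_peMl ?exprn_ge0.
by rewrite le_eqVlt; apply/orP; left; apply/eqP; ring.
Qed.

End MoreSeries.

(** Passing from b to 1 + b multiplies the exponential by exp (sum_m t^m / m) = 1 / (1 - t), which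
    sums its coefficients. The index is shifted: [b k] belongs to cycles of length k + 1. *)
Lemma partial_sums_expc (R : realType) (b : nat -> R[i]) n :
  let E n := \sum_(j < n.+1) expc b j in
  n.+1%:R * E n.+1 = \sum_(k < n.+1) (1 + b k) * E (n - k)%N.
Proof.
move=> E.
have -> : \sum_(k < n.+1) (1 + b k) * E (n - k)%N =
    \sum_(k < n.+1) E k + \sum_(m < n.+1) m.+1%:R * expc b m.+1.
  under eq_bigr do rewrite mulrDl mul1r.
  rewrite big_split /=; congr (_ + _).
    rewrite (reindex_inj rev_ord_inj) /=; apply: eq_bigr => k _.
    by rewrite subSS subKn // -ltnS.
  under [RHS]eq_bigr do rewrite expcS.
  rewrite sum_cauchyp; apply: eq_bigr => k _.
  by rewrite /E subSn // -ltnS.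
elim: n => [|n IH].
  by rewrite !big_ord1 /E !big_ord_recr big_ord0 /= !mul1r.
rewrite [X in _ = X + _]big_ord_recr [X in _ = _ + X]big_ord_recr /= addrACA -IH.
rewrite {1}/E big_ord_recr /= -/(E n.+1) mulrDr -nat1r mulrDl mul1r.
by rewrite addrA [E n.+1 + _]addrC.
Qed.

Section Expectation.
Variables (R : realType) (p : nat) (x s : 'I_p -> R[i]).

Let a (m : nat) : R[i] := \prod_(j < p) cpow (1 - x j ^+ m) (s j).

Lemma cpowMn (u c : R[i]) n : cpow u (c * n%:R) = cpow u c ^+ n.
Proof. by rewrite /cpow -cexpMn mulrAC mulr_natr. Qed.

Lemma Z_cweight n (g : 'S_n) : Z s x g = cweight a [set: 'I_n] g.
Proof.
rewrite /Z /Z1 exchange_big /=.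
transitivity (\prod_(1 <= m < n.+1) a m ^+ ncycles m g).
  apply: eq_bigr => m _; rewrite /a -prodrXl.
  by apply: eq_bigr => j _; rewrite cpowMn.
have -> : cweight a [set: 'I_n] g = \prod_(c in porbits g) a #|c|.
  rewrite /cweight /porbits; apply: eq_bigl => c; congr (c \in pred_of_set _).
  by apply/setP => d; apply/imsetP/imsetP => -[y _ ->]; exists y.
rewrite [RHS](partition_big (fun c : {set 'I_n} => inord #|c| : 'I_n.+1) xpredT) //=.
have cn (c : {set 'I_n}) : (#|c| < n.+1)%N by rewrite ltnS -[n in (_ <= n)%N]card_ord max_card.
(* Size 0 is split off: no orbit is empty, so its product is 1. *)
rewrite big_ord_recl [X in X * _]big1 ?mul1r.
  rewrite big_add1 big_mkord; apply: eq_bigr => m _.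
  rewrite /ncycles -prodr_const; apply: eq_big => c.
    by rewrite inE -val_eqE /= inordK.
  by rewrite inE => /andP[_ /eqP ->].
move=> c /andP[/imsetP[y _ ->] /eqP/(congr1 val)]; rewrite /= inordK //.
by move/eqP; rewrite (negPf (card_porbit_neq0 g y)).
Qed.

Lemma unifE_Z (b : nat -> R[i]) n : (forall k, a k.+1 = 1 + b k) ->
  unifE (fun g : 'S_n => Z s x g) = \sum_(j < n.+1) expc b j.
Proof.
move=> ab; rewrite /unifE card_Sn.
have H := @wsum_cycle_index 'I_n _ a (fun n => \sum_(j < n.+1) expc b j).
have -> : \sum_(g : 'S_n) Z s x g = wsum a [set: 'I_n]%SET.
  apply: eq_big => [g|g _]; last exact: Z_cweight.
  have -> // : perm_on [set: 'I_n]%SET g by apply/fintype.subsetP => y _; rewrite inE.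
rewrite H; first by rewrite cardsT card_ord mulrAC mulfV ?mul1r // pnatr_eq0 -lt0n fact_gt0.
  by rewrite big_ord1.
move=> m; rewrite (partial_sums_expc b m).
by apply: eq_bigr => k _; rewrite ab.
Qed.

End Expectation.

(** * Truncation of the binomial series, and the two limits *)

Section Product.
Variables (R : realType) (p : nat) (x s : 'I_p -> R[i]) (r q M : R).
Hypotheses (r0 : 0 <= r) (rq : r < q) (q1 : q < 1) (M0 : 0 <= M).
Hypothesis xr : forall j, cmod (x j) <= r.
Hypothesis sM : forall j n, cmod (cbinom (s j) n) * r ^+ n <= M * q ^+ n.

Let q0 : 0 < q. Proof. exact: le_lt_trans rq. Qed.
Let r1 : r < 1. Proof. exact: lt_trans q1. Qed.
Let r01 : 0 <= r < 1. Proof. by rewrite r0 r1. Qed.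

Let t j n (w : R[i]) : R[i] := cbinom (s j) n * (-1) ^+ n * w ^+ n.

Let cmod_t j n w : cmod (t j n w) = cmod (cbinom (s j) n) * cmod w ^+ n.
Proof. by rewrite !cmodM !cmodX cmodN cmod1 expr1n mulr1. Qed.

Let C : R := M / (1 - q).
Let C0 : 0 <= C. Proof. by rewrite divr_ge0 // subr_ge0 ltW. Qed.

Let xrX j m : cmod (x j ^+ m.+1) <= r ^+ m.+1.
Proof. by rewrite cmodX lerXn2r // nnegrE cmod_ge0. Qed.

Let factor (m : nat) j := cpow (1 - x j ^+ m.+1) (s j).
Let truncated N (m : nat) j := \sum_(n < N) t j n (x j ^+ m.+1).

(** The n-th term of the binomial series at x_j^(m+1) is at most M (q r^m)^n, so the tail has ratio
    [rho]. As N > 0, (r^m)^N <= r^m, which keeps a factor r^m for the summation over m. *)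
Let factor_tail N m j : (0 < N)%N ->
  cmod (factor m j - truncated N m j) <= C * q ^+ N * r ^+ m.
Proof.
move=> N0; set w := x j ^+ m.+1.
have w1 : cmod w < 1.
  by rewrite (le_lt_trans (xrX j m)) // exprn_ilt1.
rewrite /factor -/w -csum_binom //.
pose rho := q * r ^+ m.
have rm1 : r ^+ m <= 1 by rewrite exprn_ile1 // ltW.
have rm0 : 0 <= r ^+ m by exact: exprn_ge0.
have rho0 : 0 <= rho by rewrite mulr_ge0 // ltW.
have rhoq : rho <= q by rewrite ler_piMr // ltW.
have rho01 : 0 <= rho < 1 by rewrite rho0 (le_lt_trans rhoq).
have tM n : cmod (t j n w) <= M * rho ^+ n.
  rewrite cmod_t; apply: (@le_trans _ _ (cmod (cbinom (s j) n) * (r ^+ m.+1) ^+ n)).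
    by rewrite ler_wpM2l ?cmod_ge0 // lerXn2r ?nnegrE ?cmod_ge0 ?exprn_ge0 // xrX.
  by rewrite exprS !exprMn !mulrA ler_wpM2r ?exprn_ge0.
rewrite (le_trans (csum_tail N rho01 tM)) //.
have -> : C * q ^+ N * r ^+ m = M * (q ^+ N * r ^+ m) * (1 - q)^-1.
  by rewrite /C mulrAC; ring.
apply: ler_pM.
- by rewrite mulr_ge0 ?exprn_ge0.
- by rewrite invr_ge0 subr_ge0; case/andP: rho01 => _ /ltW.
- rewrite ler_wpM2l // /rho exprMn ler_wpM2l ?exprn_ge0 ?(ltW q0) //.
  by rewrite ler_iXnr.
rewrite lef_pV2 ?posrE ?subr_gt0 ?lerD2l ?lerN2 //.
by case/andP: rho01.
Qed.

(** Makes the bound on b_m the case N = 1 of the truncation error. *)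
Let truncated1 m j : truncated 1 m j = 1.
Proof. by rewrite /truncated big_ord1 /t /cbinom big_nil !expr0 !mul1r. Qed.

(** [factor] is within [C] of the truncation 1, and [truncated] within [C] of [factor]. *)
Let L := 1 + 2 * C.
Let L1 : 1 <= L. Proof. by rewrite lerDl mulr_ge0. Qed.

Let decay_le1 N m : q ^+ N * r ^+ m <= 1.
Proof.
by rewrite mulr_ile1 ?exprn_ge0 ?exprn_ile1 ?(ltW q0) ?(ltW q1) ?(ltW r1).
Qed.

Let tail_le N m j : (0 < N)%N -> cmod (factor m j - truncated N m j) <= C.
Proof.
move=> N0; rewrite (le_trans (factor_tail m j N0)) // -mulrA.
by rewrite ler_piMr // decay_le1.
Qed.

Let cmod_factor m j : cmod (factor m j) <= 1 + C.
Proof.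
rewrite -[factor m j](subrK (truncated 1 m j)) (le_trans (cmodD _ _)) // addrC.
by rewrite lerD ?tail_le // truncated1 cmod1.
Qed.

Let factor_le m j : cmod (factor m j) <= L.
Proof.
by rewrite (le_trans (cmod_factor m j)) // lerD2l mulr_natl mulr2n lerDl.
Qed.

Let truncated_le N m j : (0 < N)%N -> cmod (truncated N m j) <= L.
Proof.
move=> N0; rewrite -[truncated N m j](subrK (factor m j)) (le_trans (cmodD _ _)) //.
rewrite cmodB /L mulr_natl mulr2n addrCA lerD ?tail_le //.
Qed.

Let K : R := p%:R * L ^+ p * C.
Let K0 : 0 <= K.
Proof.
apply: mulr_ge0 => //; apply: mulr_ge0 => //.
exact/exprn_ge0/(le_trans ler01 L1).
Qed.

Let prod_tail N m : (0 < N)%N ->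
  cmod (\prod_(j < p) factor m j - \prod_(j < p) truncated N m j) <=
    K * q ^+ N * r ^+ m.
Proof.
move=> N0; have := @cmod_prod_sub _ _ (index_enum 'I_p) (factor m) (truncated N m)
  L (C * q ^+ N * r ^+ m) L1.
have -> : size (index_enum 'I_p) = p by rewrite -[RHS](card_ord p) cardT enumT.
have -> : K * q ^+ N * r ^+ m = p%:R * L ^+ p * (C * q ^+ N * r ^+ m).
  by rewrite /K; ring.
apply.
- apply: mulr_ge0; last exact: exprn_ge0.
  by apply: mulr_ge0 => //; apply: exprn_ge0; exact: ltW.
- exact: factor_le.
- by move=> j; exact: truncated_le.
- by move=> j; exact: factor_tail.
Qed.

Definition cycle_excess (m : nat) : R[i] := \prod_(j < p) cpow (1 - x j ^+ m.+1) (s j) - 1.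

Let b := cycle_excess.

Lemma cycle_excess_bound m : cmod (b m) <= K * r ^+ m.
Proof.
have := @prod_tail 1 m isT; rewrite [X in _ - X]big1 // => H.
rewrite (le_trans H) // ler_wpM2r ?exprn_ge0 // ler_piMr // expr1; exact: ltW.
Qed.

(** The logarithm of the factor at [k]. At k = 0 the base 1 - x^0 is 0 and has no logarithm; the
    value 0 makes this index neutral. *)
Let v (k : {ffun 'I_p -> nat}) : R[i] :=
  if k == [ffun=> 0%N] then 0 else - sbinom s k * cln (1 - mpower x k).

Let cmod_mpower k : k != [ffun=> 0%N] -> cmod (mpower x k) <= r.
Proof.
move=> k0; have /existsP[j kj] : [exists j, k j != 0%N].
  rewrite -negb_forall; apply: contra k0 => /forallP k0.
  by apply/eqP/ffunP => j; rewrite ffunE; apply/eqP.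
rewrite /mpower cmod_prod (bigD1 j) //= cmodX.
rewrite -[leRHS]mulr1; apply: ler_pM; rewrite ?exprn_ge0 ?cmod_ge0 //.
- by apply: prodr_ge0 => i _; exact: cmod_ge0.
- rewrite (le_trans _ (xr j)) // ler_iXnr ?cmod_ge0 ?lt0n //.
  by rewrite (le_trans (xr j)) // ltW.
apply: prodr_ile1 => i _; rewrite cmod_ge0 cmodX exprn_ile1 ?cmod_ge0 //.
by rewrite (le_trans (xr i)) // ltW.
Qed.

Let D := M ^+ p / (1 - r).

Let sbinom_mpower k : cmod (sbinom s k) * cmod (mpower x k) <= M ^+ p * \prod_(j < p) q ^+ k j.
Proof.
rewrite /sbinom /mpower !cmod_prod -big_split /=.
have -> : M ^+ p = \prod_(j < p) M by rewrite prodr_const card_ord.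
rewrite -big_split /=; apply: ler_prod => j _.
rewrite mulr_ge0 ?cmod_ge0 //= (le_trans _ (sM j (k j))) //.
rewrite cmodM !cmodX cmodN cmod1 expr1n mulr1 ler_wpM2l ?cmod_ge0 //.
by rewrite lerXn2r ?nnegrE ?cmod_ge0.
Qed.

Let v_bound k : cmod (v k) <= D * \prod_(j < p) q ^+ k j.
Proof.
rewrite /v; case: ifPn => [_|k0].
  rewrite cmod0 mulr_ge0 ?prodr_ge0 // => [|j _]; last by rewrite exprn_ge0 // ltW.
  by rewrite divr_ge0 ?exprn_ge0 // subr_ge0 ltW.
have w1 := cmod_mpower k0; have w1' := le_lt_trans w1 r1.
rewrite cmodM cmodN cln_1sub //.
apply: (@le_trans _ _ (cmod (sbinom s k) * (cmod (mpower x k) / (1 - r)))).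
  rewrite ler_wpM2l ?cmod_ge0 // (le_trans (cmod_clog1 w1')) //.
  by rewrite ler_wpM2l ?cmod_ge0 // lef_pV2 ?posrE ?subr_gt0 // lerD2l lerN2.
by rewrite mulrA /D [leRHS]mulrAC ler_wpM2r ?sbinom_mpower // invr_ge0 subr_ge0 ltW.
Qed.

(** Terms of the logarithm series behind [v k]. The indicator cancels the term of k = 0, so that a
    sum over a box is a truncated product minus 1, divided by m + 1. *)
Let u k (m : nat) : R[i] :=
  (sbinom s k * mpower x k ^+ m.+1 - (k == [ffun=> 0%N])%:R) / m.+1%:R.

Let sbinom0 : sbinom s [ffun=> 0%N] = 1.
Proof.
by rewrite /sbinom big1 // => j _; rewrite ffunE /cbinom big_nil mul1r.
Qed.

Let mpower0 : mpower x [ffun=> 0%N] = 1.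
Proof. by rewrite /mpower big1 // => j _; rewrite ffunE. Qed.

Let u_bound k m : cmod (u k m) <= cmod (sbinom s k) * r ^+ m.
Proof.
rewrite /u; have [->|k0] := eqVneq k [ffun=> 0%N].
  by rewrite sbinom0 mpower0 expr1n mul1r subrr mul0r cmod0 mulr_ge0 ?cmod_ge0 ?exprn_ge0.
rewrite subr0 !cmodM cmodV cmod_nat -mulrA ler_wpM2l ?cmod_ge0 //.
rewrite cmodX ler_pdivrMr ?ltr0n // (@le_trans _ _ (r ^+ m.+1)) //.
  by rewrite lerXn2r ?nnegrE ?cmod_ge0 // cmod_mpower.
rewrite exprSr ler_wpM2l ?exprn_ge0 // (@le_trans _ _ 1) ?ler1n //.
exact: ltW.
Qed.

Let v_csum k : v k = csum (u k).
Proof.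
rewrite /v /u; have [->|k0] := eqVneq k [ffun=> 0%N].
  rewrite -[LHS]csum0; congr csum; apply/funext => m.
  by rewrite sbinom0 mpower0 expr1n mul1r subrr mul0r.
have w1' := le_lt_trans (cmod_mpower k0) r1.
rewrite cln_1sub // /clog1 -(@csumZ _ _ _ 1 r) //.
  by congr csum; apply/funext => m; rewrite subr0 !mulNr mulrN opprK mulrA.
move=> m; rewrite mul1r cmodM cmodN cmodV cmod_nat cmodX ler_pdivrMr ?ltr0n //.
rewrite (@le_trans _ _ (r ^+ m.+1)) //.
  by rewrite lerXn2r ?nnegrE ?cmod_ge0 // cmod_mpower.
rewrite exprSr ler_wpM2l ?exprn_ge0 // (@le_trans _ _ 1) ?ler1n //.
exact: ltW.
Qed.

(** Only finitely many series are added, so the sums can be exchanged, and distributivity folds the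
    box into a product. N > 0 puts k = 0 in the box, whence the - 1. *)
Let sum_kbox_v N : (0 < N)%N -> \sum_(k <- kbox p N) v k =
  csum (fun m => (\prod_(j < p) truncated N m j - 1) / m.+1%:R).
Proof.
move=> N0; under eq_bigr do rewrite v_csum.
rewrite -(csum_sum _ r01 u_bound); congr csum; apply/funext => m.
rewrite /u -mulr_suml sumrB; congr ((_ - _) / _).
  rewrite /truncated -(sum_kbox (fun j n => t j n (x j ^+ m.+1))).
  apply: eq_bigr => k _; rewrite /sbinom /mpower -prodrXl -big_split /=.
  by apply: eq_bigr => j _; rewrite /t -!exprM [(k j * _)%N]mulnC.
rewrite (big_fsetD1 [ffun=> 0%N]) /=; last first.
  by rewrite mem_kbox; apply/forallP => j; rewrite ffunE.
rewrite eqxx big_seq big1 ?addr0 // => k.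
by rewrite !inE => /andP[/negPf->].
Qed.

Let S := csum (fun m => b m / m.+1%:R).

(** The truncation error K q^N r^m is summed over m, which leaves a multiple of q^N. *)
Lemma cvg_kbox_v : ((fun N => \sum_(k <- kbox p N) v k) : nat -> R[i]^o) @ \oo --> (S : R[i]^o).
Proof.
apply/cvg_cmodP; rewrite -cvg_shiftS.
apply: (@cvg_squeeze0 _ _ (fun N => K / (1 - r) * q * q ^+ N)); last first.
  by apply: cvg_geo0; rewrite q1 ltW.
move=> N; rewrite cmod_ge0 /= sum_kbox_v //.
have bM m : cmod (b m / m.+1%:R) <= (K + K) * r ^+ m.
  rewrite (le_trans (div_succ_bound cycle_excess_bound m)) //.
  by rewrite ler_wpM2r ?exprn_ge0 // lerDl.
have dM m : cmod ((\prod_(j < p) factor m j - \prod_(j < p) truncated N.+1 m j) / m.+1%:R)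
    <= K * q ^+ N.+1 * r ^+ m.
  rewrite cmodM cmodV cmod_nat (le_trans _ (prod_tail m _)) // ler_piMr ?cmod_ge0 //.
  by rewrite invf_le1 ?ltr0n // ler1n.
have dM' m : cmod ((\prod_(j < p) factor m j - \prod_(j < p) truncated N.+1 m j) / m.+1%:R)
    <= (K + K) * r ^+ m.
  rewrite (le_trans (dM m)) // ler_wpM2r ?exprn_ge0 // (@le_trans _ _ K) ?lerDl //.
  by rewrite ler_piMr // exprn_ile1 // ltW.
have -> : csum (fun m => (\prod_(j < p) truncated N.+1 m j - 1) / m.+1%:R) = S -
   csum (fun m => (\prod_(j < p) factor m j - \prod_(j < p) truncated N.+1 m j) / m.+1%:R).
  rewrite -(csumB r01 bM dM'); congr csum; apply/funext => m.
  by rewrite -mulrBl; congr (_ / _); rewrite /b /cycle_excess; ring.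
rewrite addrAC subrr add0r cmodN (le_trans (csum_le r01 dM)) //.
by rewrite exprS le_eqVlt; apply/orP; left; apply/eqP; ring.
Qed.

Lemma has_infprod_cycle_excess :
  has_infprod [set k : {ffun 'I_p -> nat} | k <> [ffun=> 0%N]]
    (fun k => cpow (1 - mpower x k) (- sbinom s k)) (cexp S).
Proof.
apply: (has_infprod_kbox (ltW q0) q1 v_bound _ _ cvg_kbox_v).
  by rewrite /v eqxx.
by move=> k /eqP k0; rewrite /v (negPf k0).
Qed.

Lemma cvg_unifE_Z :
  (fun n : nat => unifE (fun g : 'S_n => Z s x g) : R[i]^o) @ \oo
      --> (cexp S : R[i]^o).
Proof.
rewrite -(csum_expc r01 K0 cycle_excess_bound).
have [M' _ HM'] := expc_bound r0 rq K0.
have q01 : 0 <= q < 1 by rewrite (ltW q0).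
have H := csum_cvg q01 (HM' _ cycle_excess_bound).
(* [series] at n stops before index n, while e_n includes the coefficient of index n. *)
rewrite -cvg_shiftS in H.
apply: cvg_trans H; apply: near_eq_cvg; near=> n.
rewrite /series /= big_mkord; apply/esym/unifE_Z => k.
by rewrite /cycle_excess addrC subrK.
Unshelve. all: by end_near. Qed.

End Product.

Theorem theorem3p1 (R : realType) (p : nat) (hp : (1 <= p)%N)
    (x s : 'I_p -> R[i]) (hx : forall k : 'I_p, `|x k| < 1) :
  exists l : R[i],
    has_infprod [set k : {ffun 'I_p -> nat} | k <> [ffun=> 0%N]]
      (fun k => cpow (1 - mpower x k) (- sbinom s k)) l /\
    (fun n : nat => unifE (fun g : 'S_n => Z s x g) : R[i]^o) @ \oo
      --> (l : R[i]^o).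
Proof.
pose r : R := \big[Num.max/0]_(k < p) cmod (x k).
have xr k : cmod (x k) <= r by exact: le_bigmax.
have r0 : 0 <= r by exact: bigmax_ge_id.
have r1 : r < 1.
  by apply: bigmax_lt => // k _; rewrite -ltc1_cmod.
have r01 : 0 <= r < 1 by rewrite r0.
have [q0 q1 rq _] := half_rate r01.
set q := (1 + r) / 2 in q0 q1 rq.
have [M M0 HM] := fin_all_exists2 (fun j => cbinom_bound (s j) r0 rq q1).
have sM j n : cmod (cbinom (s j) n) * r ^+ n <= (\sum_i M i) * q ^+ n.
  rewrite (le_trans (HM j n)) // ler_wpM2r ?exprn_ge0 ?(ltW q0) //.
  by rewrite (bigD1 j) //= lerDl sumr_ge0.
have SM0 : 0 <= \sum_i M i by exact: sumr_ge0.
exists (cexp (csum (fun m => cycle_excess x s m / m.+1%:R))); split.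
  exact: (has_infprod_cycle_excess r0 rq q1 SM0 xr sM).
exact: (cvg_unifE_Z r0 rq q1 SM0 xr sM).
Qed.
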